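(* Let $G$ be a metrizable locally compact Abelian group. Then every $B(G)$-interpolation set is an approximable $\mathscr B(G)$-interpolation set.
   Context: $B(G)$ is the Fourier–Stieltjes algebra of $G$: the linear span of the continuous positive definite functions on $G$. $\mathscr B(G)=\overline{B(G)}^{\|\cdot\|_\infty}$ is its uniform closure (the Eberlein algebra). Let $\mathcal A(G)$ be a set of bounded scalar-valued functions on a topological group $G$ with identity $e$. A set $T\subseteq G$ is an $\mathcal A(G)$-interpolation set if every bounded $f:T\to\mathbb C$ extends to a function in $\mathcal A(G)$. It is an approximable $\mathcal A(G)$-interpolation set if it is an $\mathcal A(G)$-interpolation set and for every neighbourhood $U$ of $e$ there are open neighbourhoods $V_1,V_2$ of $e$ with $\overline{V_1}\subseteq V_2\subseteq U$ such that for each $T_1\subseteq T$ there is $h\in\mathcal A(G)$ with $h(V_1T_1)\subseteq\{1\}$ and $h(G\setminus V_2T_1)\subseteq\{0\}$. *)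

(* Defs.v *)
From mathcomp Require Import all_boot all_order all_algebra.
From mathcomp Require Import complex.
From mathcomp Require Import all_classical all_reals all_analysis.
Set Implicit Arguments.
Unset Strict Implicit.
Unset Printing Implicit Defensive.
Import Order.TTheory GRing.Theory Num.Theory.
Import numFieldNormedType.Exports.
Local Open Scope classical_set_scope.
Local Open Scope ring_scope.

(* Naming the numClosedFieldType structure on R[i] is what makes the norm
   topology and uniformity of a numFieldType available on it. *)
Definition cplx (R : realType) : numClosedFieldType := R[i]%C.

Definition metrizable (R : realType) (T : topologicalType) : Prop :=
  exists d : T -> T -> R,
    [/\ forall x y, d x y = 0 <-> x = y,
        forall x y, d x y = d y x,
        forall x y z, d x z <= d x y + d y z
      & forall x : T, nbhs x = nbhs_ball_ (fun y e => [set z | d y z < e]) x].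

(* Abelian groups are written additively: the product set V T is the set of
   sums v + t, the identity e is 0, and x y^-1 is x - y. *)

(* The order of [cplx R] satisfies 0 <= z iff z is a nonnegative real. *)
Definition positive_definite (R : realType) (G : topologicalZmodType)
    (phi : G -> cplx R) : Prop :=
  forall (n : nat) (x : 'I_n -> G) (c : 'I_n -> cplx R),
    0 <= \sum_(i < n) \sum_(j < n) c i * (c j)^* * phi (x i - x j).

Definition fourier_stieltjes (R : realType) (G : topologicalZmodType) :
    set (G -> cplx R) :=
  [set f | exists (n : nat) (a : 'I_n -> cplx R) (phi : 'I_n -> G -> cplx R),
     (forall i, continuous (phi i) /\ positive_definite (phi i)) /\
     f = (fun x => \sum_(i < n) a i * phi i x)].

Definition eberlein (R : realType) (G : topologicalZmodType) :
    set (G -> cplx R) :=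
  closure (@fourier_stieltjes R G : set {uniform G -> cplx R}).

(* A function on T is represented by a total function on G, of which only the
   restriction to T matters. *)
Definition interpolation_set (R : realType) (G : topologicalZmodType)
    (A : set (G -> cplx R)) (T : set G) : Prop :=
  forall f : G -> cplx R, [bounded f t | t in T] ->
    exists2 g : G -> cplx R, A g & forall t, T t -> g t = f t.

Definition approximable_interpolation_set (R : realType)
    (G : topologicalZmodType) (A : set (G -> cplx R)) (T : set G) : Prop :=
  interpolation_set A T /\
  forall U : set G, nbhs 0 U ->
    exists V1 V2 : set G,
      [/\ open_nbhs 0 V1, open_nbhs 0 V2, closure V1 `<=` V2, V2 `<=` U
        & forall T1 : set G, T1 `<=` T ->
            exists h : G -> cplx R,
              [/\ A h,
                  h @` [set v + t | v in V1 & t in T1] `<=` [set 1]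
                & h @` (~` [set v + t | v in V2 & t in T1]) `<=` [set 0]]].

(* Main.v *)
Require Import Defs.
From mathcomp Require Import all_boot all_order all_algebra.
From mathcomp Require Import complex ring lra.
From mathcomp Require Import all_classical all_reals all_analysis.
Set Implicit Arguments.
Unset Strict Implicit.
Unset Printing Implicit Defensive.
Import Order.TTheory GRing.Theory Num.Theory.
Import numFieldNormedType.Exports.
Local Open Scope classical_set_scope.
Local Open Scope ring_scope.

(* Drury's argument, on a group that need not be discrete. A gliding hump shows
   that off some finite set F0 every pattern on a finite F in T is realised by a
   function of B(G) whose norm and modulus of continuity do not depend on F. Let
   phi_t be such functions, t ranging over the characters of (Z/4)^F, let c_S(x)
   be the Fourier coefficients of t |-> phi_t(x), and let w be continuous and
   positive definite with w(0) = 1 and small support. Averaging phi_t phi_t'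
   against a Riesz product with parameter eps gives a function
     sum_{deg S = 1} eps^(|S| - 1) c_S(x)^2 w(x - S.F)
   (S in {-1,0,1}^F, deg S its sum mod 4, |S| its number of nonzero entries) whose norm in B(G) does not depend
   on F, because the Riesz product is positive and has mean 1. By Parseval it is
   close to w(x - e) near each e in F and O(eps) away from F. A pointwise limit
   over F of its positive definite parts need not be continuous, so they are first
   convolved with a bump k and its reflection, which makes them equicontinuous in a
   way that depends on their bound only. The limit is close to 1 near T1 \ F0 and
   to 0 far from it; adding translates of w for the points of F0 and clamping by a
   continuous function, which the uniform closure of B(G) allows, gives exact
   values. *)

(** * Complex modulus *)

(** The coefficients c_S enter squared because Parseval controls only the sum of |c_S|^2; averaging
    over two independent characters t and t' produces the square. The condition deg S = 1 is there
    because the Riesz product gets divided by eps: S = 0 would receive weight 1/eps, and the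
    negative singletons, of degree 3, would put spurious humps at the points -e. Both are removed,
    and the singletons keep weight 1. Fourth roots of unity are convenient twice: 0, 1 and -1 stay
    distinct in Z/4, and the same roots are the coefficients of four positive definite functions
    that build any element of B(G), so multiplying by a character value costs nothing in norm.

    V1 and V2 must be fixed before T1. So whatever they depend on, the modulus of continuity of the
    interpolating functions, w and the smoothing kernel, is chosen from T and U alone. Metrizability
    gives the countable base at 0 on which the gliding hump runs, and the continuous bumps. Of Haar
    measure only positivity, invariance and nonvanishing matter, so a finitely additive integral
    suffices. *)

Section Complex.
Variable R : realType.
Local Notation C := (cplx R).
Implicit Types (z w : C) (r : R).

Definition rc r : C := (r%:C)%C.
Definition modc z : R := complex.Re `|z|.

Lemma rcD r s : rc (r + s) = rc r + rc s. Proof. exact: (rmorphD (real_complex R)). Qed.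
Lemma rcN r : rc (- r) = - rc r. Proof. exact: (rmorphN (real_complex R)). Qed.
Lemma rcB r s : rc (r - s) = rc r - rc s. Proof. exact: (rmorphB (real_complex R)). Qed.
Lemma rcM r s : rc (r * s) = rc r * rc s. Proof. exact: (rmorphM (real_complex R)). Qed.
Lemma rc1 : rc 1 = 1. Proof. by []. Qed.
Lemma rc0 : rc 0 = 0. Proof. by []. Qed.
Lemma rcV r : rc r^-1 = (rc r)^-1. Proof. exact: (fmorphV (real_complex R)). Qed.

Lemma ge0cP z : 0 <= z <-> complex.Im z = 0 /\ 0 <= complex.Re z.
Proof.
split; first by rewrite (lecE (0 : R[i]) z) /= => /andP[/eqP].
by case=> h1 h2; rewrite (lecE (0 : R[i]) z) /= h1 eqxx.
Qed.

Lemma rc_ge0 r : (0 <= rc r) = (0 <= r). Proof. exact: ler0c. Qed.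

Lemma modcE z : `|z| = rc (modc z).
Proof. by rewrite /modc (normc_def z). Qed.

Lemma modc_ge0 z : 0 <= modc z.
Proof. by rewrite -rc_ge0 -modcE. Qed.

Lemma rc_inj : injective rc. Proof. exact: complexI. Qed.

Lemma modcM z w : modc (z * w) = modc z * modc w.
Proof. by apply: rc_inj; rewrite rcM -!modcE normrM. Qed.
Lemma modcD z w : modc (z + w) <= modc z + modc w.
Proof.
rewrite -lecR -[X in (X <= _)%R]/(rc _) -[X in (_ <= X)%R]/(rc _) rcD -!modcE.
exact: ler_normD.
Qed.
Lemma modcN z : modc (- z) = modc z.
Proof. by apply: rc_inj; rewrite -!modcE normrN. Qed.
Lemma modcB z w : modc (z - w) = modc (w - z).
Proof. by rewrite -modcN opprB. Qed.
Lemma modc0 : modc 0 = 0. Proof. by rewrite /modc normr0. Qed.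
Lemma modc1 : modc 1 = 1. Proof. by rewrite /modc normr1. Qed.
Lemma modc_rc r : modc (rc r) = `|r|.
Proof. by rewrite /modc (normc_def (rc r)) /= expr0n addr0 sqrtr_sqr. Qed.
Lemma modc_eq0 z : modc z = 0 -> z = 0.
Proof. by move=> h; apply/normr0_eq0; rewrite modcE h. Qed.
Lemma modcJ z : modc z^* = modc z.
Proof. by apply: rc_inj; rewrite -!modcE norm_conjC. Qed.
Lemma Re_le_modc z : `|complex.Re z| <= modc z.
Proof. by rewrite -lecR; apply: (le_trans (normc_ge_Re z)); rewrite modcE. Qed.
Lemma modc_sqr z : modc z ^+ 2 = complex.Re z ^+ 2 + complex.Im z ^+ 2.
Proof.
rewrite /modc (normc_def z) /= sqr_sqrtr //; apply: addr_ge0; exact: sqr_ge0.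
Qed.
Lemma mulJ_modc z : z * z^* = rc (modc z ^+ 2).
Proof. by rewrite -normCK modcE !expr2 rcM. Qed.
Lemma ReD z w : complex.Re (z + w) = complex.Re z + complex.Re w.
Proof. by case: z w => [a b] [c d]. Qed.
Lemma ImD z w : complex.Im (z + w) = complex.Im z + complex.Im w.
Proof. by case: z w => [a b] [c d]. Qed.
Lemma ge0_rc z : 0 <= z -> z = rc (complex.Re z).
Proof. by move/ge0cP; case: z => a b /= [-> _]. Qed.
Lemma conjE z : z^* = (complex.Re z -i* complex.Im z)%C.
Proof. by case: z => a b. Qed.
Lemma conj_rc r : (rc r)^* = rc r.
Proof. by rewrite conjE /= oppr0. Qed.

Lemma conjM z w : (z * w)^* = z^* * w^*.
Proof. exact: (rmorphM (@Num.conj C)). Qed.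

Definition ic : C := (0 +i* 1)%C.

Lemma ReM z w : complex.Re (z * w) =
  complex.Re z * complex.Re w - complex.Im z * complex.Im w.
Proof. by case: z w => [a b] [c d]. Qed.
Lemma ImM z w : complex.Im (z * w) =
  complex.Re z * complex.Im w + complex.Im z * complex.Re w.
Proof. by case: z w => [a b] [c d]. Qed.
Lemma ReN z : complex.Re (- z) = - complex.Re z. Proof. by case: z. Qed.
Lemma ImN z : complex.Im (- z) = - complex.Im z. Proof. by case: z. Qed.
Lemma ReJ z : complex.Re z^* = complex.Re z. Proof. by rewrite conjE. Qed.
Lemma ImJ z : complex.Im z^* = - complex.Im z. Proof. by rewrite conjE. Qed.
Lemma Re_rc r : complex.Re (rc r) = r. Proof. by []. Qed.
Lemma Im_rc r : complex.Im (rc r) = 0. Proof. by []. Qed.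
Lemma Re_ic : complex.Re ic = 0. Proof. by []. Qed.
Lemma Im_ic : complex.Im ic = 1. Proof. by []. Qed.
Lemma Re_0 : complex.Re (0 : C) = 0. Proof. by []. Qed.
Lemma Im_0 : complex.Im (0 : C) = 0. Proof. by []. Qed.
Lemma Re_1 : complex.Re (1 : C) = 1. Proof. by []. Qed.
Lemma Im_1 : complex.Im (1 : C) = 0. Proof. by []. Qed.

Definition ReImE := (ReD, ImD, ReN, ImN, ReM, ImM, ReJ, ImJ, Re_rc, Im_rc,
  Re_ic, Im_ic, Re_0, Im_0, Re_1, Im_1).

Lemma complex_ext z w :
  complex.Re z = complex.Re w -> complex.Im z = complex.Im w -> z = w.
Proof. by case: z w => [a b] [c d] /= -> ->. Qed.

Lemma Re_sum (J : Type) (s : seq J) (P : pred J) (F : J -> C) :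
  complex.Re (\sum_(i <- s | P i) F i) = \sum_(i <- s | P i) complex.Re (F i).
Proof. exact: (big_morph (@complex.Re R) ReD Re_0). Qed.

Lemma rc_sum (J : Type) (s : seq J) (P : pred J) (F : J -> R) :
  rc (\sum_(i <- s | P i) F i) = \sum_(i <- s | P i) rc (F i).
Proof. exact: (big_morph rc rcD rc0). Qed.

Lemma modc_sum (J : Type) (s : seq J) (P : pred J) (F : J -> C) :
  modc (\sum_(i <- s | P i) F i) <= \sum_(i <- s | P i) modc (F i).
Proof.
elim/big_rec2: _ => [|i x y _ h]; first by rewrite modc0.
by apply: le_trans (modcD _ _) _; rewrite lerD2l.
Qed.

End Complex.

Arguments rc {R} r.
Arguments modc {R} z.

(** * Positive definite functions *)

Section PositiveDefinite.
Variables (R : realType) (G : topologicalZmodType).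
Local Notation C := (cplx R).
Implicit Types (phi psi : G -> C).

Lemma pd_fin phi : positive_definite phi ->
  forall (J : finType) (x : J -> G) (c : J -> C),
    0 <= \sum_i \sum_j c i * (c j)^* * phi (x i - x j).
Proof.
move=> pd J x c.
have := pd #|J| (x \o enum_val) (c \o enum_val).
congr (0 <= _).
rewrite [RHS](reindex (@enum_val J predT)) /=; last first.
  exact/onW_bij/enum_val_bij.
apply: eq_bigr => i _.
rewrite [RHS](reindex (@enum_val J predT)) //=.
exact/onW_bij/enum_val_bij.
Qed.

Lemma pd_two phi (x : G) (a b : C) : positive_definite phi ->
  0 <= a * a^* * phi 0 + a * b^* * phi x + (b * a^* * phi (- x) + b * b^* * phi 0).
Proof.
move=> /pd_fin /(_ bool (fun i => if i then x else 0) (fun i => if i then a else b)).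
by rewrite !big_bool /= !subrr subr0 sub0r.
Qed.

Lemma pd0_ge0 phi : positive_definite phi -> 0 <= phi 0.
Proof.
move=> /(pd_two 0 1 0).
by rewrite !conjC0 !(mulr0, mul0r, addr0) conjC1 !mul1r.
Qed.

Lemma pdN phi x : positive_definite phi -> phi (- x) = (phi x)^*.
Proof.
move=> pd; have /ge0cP[h0 _] := pd0_ge0 pd.
(* Coefficients 1, 1 make the imaginary parts of [phi x] and [phi (- x)] opposite; coefficients 1, i
   make the real parts equal. *)
have /ge0cP[h1 _] := pd_two x 1 1 pd.
have /ge0cP[h2 _] := pd_two x 1 (ic R) pd.
by move: h1 h2; rewrite !ReImE h0 => h1 h2; apply: complex_ext; rewrite !ReImE; lra.
Qed.

Lemma pd_bound phi x : positive_definite phi ->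
  modc (phi x) <= complex.Re (phi 0).
Proof.
move=> pd; have /ge0cP[h0 f0] := pd0_ge0 pd.
(* With m = |phi x| these coefficients give 0 <= 2 m^2 (phi 0 - m). *)
have /ge0cP[_] := pd_two x (rc (modc (phi x))) (- phi x) pd.
rewrite pdN // !ReImE h0 => h.
have m2 := modc_sqr (phi x); have m0 := modc_ge0 (phi x).
move: h m2 m0 f0; move: (complex.Re _) (complex.Im _) (modc _) (complex.Re _).
move=> a b m f h m2 m0 f0.
rewrite leNgt; apply/negP => fm.
have mp : 0 < m by apply: le_lt_trans fm.
have : m ^+ 2 * (f - m) < 0 by rewrite pmulr_rlt0 ?exprn_gt0 // subr_lt0.
nra.
Qed.

(* Krein's inequality, from the positivity of [phi] on the points [x], [y], [0]
   with coefficients [c], [- c], [1]. *)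
Lemma pd_krein phi x y : positive_definite phi ->
  modc (phi x - phi y) ^+ 2 <=
    2 * complex.Re (phi 0) * (complex.Re (phi 0) - complex.Re (phi (x - y))).
Proof.
move=> pd; have /ge0cP[h0 f0] := pd0_ge0 pd.
set D := phi x - phi y.
have key t : 0 <= t ^+ 2 * modc D ^+ 2 *
    (2 * (complex.Re (phi 0) - complex.Re (phi (x - y)))) - 2 * t * modc D ^+ 2
    + complex.Re (phi 0).
  pose z := rc t * D^*.
  have /ge0cP[_] := pd 3 (fun i => nth 0 [:: x; y; 0] i)
    (fun i => nth 0 [:: - z; z; 1] i).
  rewrite !big_ord_recl !big_ord0 /= !addr0 !subrr !sub0r !subr0.
  rewrite -[y - x]opprB !pdN // /z !ReImE h0 modc_sqr /D !ReImE.
  by congr (0 <= _); ring.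
have A0 : 0 <= complex.Re (phi 0) - complex.Re (phi (x - y)).
  by rewrite subr_ge0 (le_trans _ (pd_bound (x - y) pd)) // (le_trans (ler_norm _)) //
    Re_le_modc.
move: key A0 (sqr_ge0 (modc D)) f0.
move: (complex.Re (phi 0) - complex.Re (phi (x - y))) (modc D ^+ 2).
move: (complex.Re (phi 0)).
(* [key] is a quadratic in t. If A = 0 it is affine, and t = (f + 1) / m makes it negative unless m
   = 0; otherwise it is evaluated at its minimum t = 1 / (2 A). *)
move=> f A m key; rewrite le_eqVlt => /predU1P[A0|A0] m0 f0.
  rewrite -A0 mulr0 leNgt; apply/negP => mp.
  have := key ((f + 1) / m).
  by rewrite -A0 !mulr0 add0r -mulrA divfK ?gt_eqF // => h; lra.
have := key ((2 * A)^-1).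
have -> : (2 * A)^-1 ^+ 2 * m * (2 * A) - 2 * (2 * A)^-1 * m + f = f - m / (2 * A).
  by field; rewrite gt_eqF.
rewrite subr_ge0 ler_pdivrMr; last by lra.
by move=> h; apply: le_trans h _; rewrite le_eqVlt; apply/orP; left; apply/eqP; ring.
Qed.

Lemma pd_sum (J : finType) (psi : J -> G -> C) :
  (forall j, positive_definite (psi j)) ->
  positive_definite (fun x => \sum_j psi j x).
Proof.
move=> pd n x c.
suff -> : \sum_(i < n) \sum_(j < n) c i * (c j)^* * (\sum_k psi k (x i - x j)) =
    \sum_k \sum_(i < n) \sum_(j < n) c i * (c j)^* * psi k (x i - x j).
  by apply: sumr_ge0 => k _; apply: pd.
rewrite [RHS]exchange_big /=; apply: eq_bigr => i _.
rewrite [RHS]exchange_big /=; apply: eq_bigr => j _.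
by rewrite mulr_sumr.
Qed.

Lemma pd_scale phi (a : C) : 0 <= a -> positive_definite phi ->
  positive_definite (fun x => a * phi x).
Proof.
move=> a0 pd n x c.
suff -> : \sum_(i < n) \sum_(j < n) c i * (c j)^* * (a * phi (x i - x j)) =
    a * \sum_(i < n) \sum_(j < n) c i * (c j)^* * phi (x i - x j).
  by rewrite mulr_ge0.
rewrite mulr_sumr; apply: eq_bigr => i _; rewrite mulr_sumr; apply: eq_bigr => j _.
by rewrite mulrCA.
Qed.

(** This is [phi] convolved with a discrete measure and its reflection: its form at the points [x i]
    is that of [phi] at the points [x i - y a] with coefficients [c i * d a]. Riesz products,
    smoothing and translates all rest on it. *)
Lemma pd_conv phi (J : finType) (y : J -> G) (d : J -> C) :
  positive_definite phi ->
  positive_definite (fun x => \sum_a \sum_b d a * (d b)^* * phi (x - y a + y b)).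
Proof.
move=> /pd_fin pd n x c.
have := pd ('I_n * J)%type (fun p => x p.1 - y p.2) (fun p => c p.1 * d p.2).
congr (0 <= _).
transitivity (\sum_(i < n) \sum_a \sum_(j < n) \sum_b
   c i * d a * (c j * d b)^* * phi (x i - y a - (x j - y b))).
  rewrite [RHS]pair_bigA; apply: eq_bigr => -[i a] _ /=.
  by rewrite [RHS]pair_bigA; apply: eq_bigr => -[j b].
apply: eq_bigr => i _; rewrite exchange_big /=; apply: eq_bigr => j _.
rewrite mulr_sumr; apply: eq_bigr => a _; rewrite mulr_sumr.
apply: eq_bigr => b _; rewrite rmorphM.
have -> : x i - y a - (x j - y b) = x i - x j - y a + y b.
  by rewrite opprB [y b - x j]addrC addrA [x i - y a - x j]addrAC.
by rewrite !mulrA [c i * d a * _]mulrAC.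
Qed.

Lemma ge0c_closed (z : C) :
  (forall e : R, 0 < e -> exists2 y : C, 0 <= y & modc (z - y) <= e) -> 0 <= z.
Proof.
move=> h; apply/ge0cP; split.
  apply/eqP; rewrite -normr_eq0; apply/eqP/le_anti; rewrite normr_ge0 andbT.
  apply/ler_addgt0Pr => e e0; rewrite add0r.
  have [y /ge0cP[y1 y2] yz] := h _ e0.
  apply: le_trans yz; rewrite -ler_sqr ?nnegrE ?modc_ge0 //.
  by rewrite modc_sqr real_normK ?num_real // !ReImE y1 subr0 lerDr sqr_ge0.
apply/ler_addgt0Pr => e e0.
have [y /ge0cP[y1 y2] yz] := h _ e0.
have := le_trans (Re_le_modc _) yz; rewrite !ReImE ler_norml => /andP[]; lra.
Qed.

Lemma pd_closed phi :
  (forall e : R, 0 < e ->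
     exists2 psi, positive_definite psi & forall x, modc (phi x - psi x) <= e) ->
  positive_definite phi.
Proof.
move=> h n x c; apply: ge0c_closed => e e0.
pose M := \sum_(i < n) \sum_(j < n) modc (c i * (c j)^*).
have M0 : 0 <= M by apply: sumr_ge0 => i _; apply: sumr_ge0 => j _; exact: modc_ge0.
have e1 : 0 < e / (M + 1) by rewrite divr_gt0 // ltr_wpDl.
have [psi pd hp] := h _ e1; exists (\sum_(i < n) \sum_(j < n)
  c i * (c j)^* * psi (x i - x j)); first exact: pd.
rewrite -sumrB; apply: le_trans (modc_sum _ _ _) _.
have : M * (e / (M + 1)) <= e.
  by rewrite mulrA ler_pdivrMr ?ltr_wpDl // [M * e]mulrC ler_pM2l //; lra.
apply: le_trans; rewrite mulr_suml; apply: ler_sum => i _.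
rewrite -sumrB; apply: le_trans (modc_sum _ _ _) _; rewrite mulr_suml.
apply: ler_sum => j _; rewrite -mulrBr [X in X <= _]modcM.
by apply: ler_wpM2l; [exact: modc_ge0|].
Qed.

End PositiveDefinite.

(** * Products of positive definite functions *)

Section SchurProduct.
Local Open Scope sesquilinear_scope.
Local Notation "M ^t*" := (map_mx Num.conj (M^T)) : sesquilinear_scope.

(** Diagonalise [A]: testing the form on the rows of the spectral unitary shows that the eigenvalues
    are nonnegative, and their square roots are absorbed into the eigenvectors. *)
Lemma schur_gram (F : numClosedFieldType) n (A : 'M[F]_n) :
  (forall i j, A j i = (A i j)^*) ->
  (forall c : 'I_n -> F, 0 <= \sum_i \sum_j c i * (c j)^* * A i j) ->
  exists u : 'I_n -> 'I_n -> F, forall i j, A i j = \sum_k (u k i) * (u k j)^*.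
Proof.
move=> Aherm Apos.
have /hermitian_normalmx /orthomx_spectralP AE : A \is hermsymmx.
  apply/is_hermitianmxP; rewrite expr0 scale1r.
  by apply/matrixP => i j; rewrite !mxE.
set P := spectralmx A in AE; set D := spectral_diag A in AE.
have PU : P \is unitarymx := spectral_unitarymx A.
have D0 k : 0 <= D 0 k.
  have -> : D 0 k = (P *m A *m P^t*) k k.
    rewrite {1}AE invmx_unitary // !mulmxA (unitarymxP PU) mul1mx -mulmxA.
    by rewrite (unitarymxP PU) mulmx1 mxE eqxx mulr1n.
  rewrite mxE; have := Apos (P k).
  congr (0 <= _); rewrite exchange_big /=; apply: eq_bigr => i _.
  rewrite !mxE mulr_suml; apply: eq_bigr => j _; ring.
exists (fun k i => sqrtC (D 0 k) * (P k i)^*) => i j.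
rewrite {1}AE invmx_unitary // !mxE; apply: eq_bigr => k _.
rewrite mul_mx_diag !mxE. rewrite [X in _ = _ * X]rmorphM /= conjCK.
have -> : (sqrtC (D 0 k))^* = sqrtC (D 0 k).
  by apply/CrealP; rewrite ger0_real ?sqrtC_ge0.
rewrite -[D 0 k in LHS]sqrtCK expr2; ring.
Qed.

End SchurProduct.

(** The Gram decomposition of the matrix of [phi] splits the form of the product into forms of [psi]
    with coefficients [c i * u k i]. *)
Lemma pd_mul (R : realType) (G : topologicalZmodType) (phi psi : G -> cplx R) :
  positive_definite phi -> positive_definite psi ->
  positive_definite (fun x => phi x * psi x).
Proof.
move=> pf ps n x c.
have [||u uE] := @schur_gram _ n (\matrix_(i, j) phi (x i - x j)).
- by move=> i j; rewrite !mxE -opprB pdN.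
- move=> d; have := pf n x d; congr (0 <= _).
  by apply: eq_bigr => i _; apply: eq_bigr => j _; rewrite mxE.
suff -> : \sum_(i < n) \sum_(j < n) c i * (c j)^* * (phi (x i - x j) * psi (x i - x j)) =
   \sum_(k < n) \sum_(i < n) \sum_(j < n)
     (c i * u k i) * (c j * u k j)^* * psi (x i - x j).
  by apply: sumr_ge0 => k _; apply: ps.
rewrite [RHS]exchange_big /=; apply: eq_bigr => i _.
rewrite [RHS]exchange_big /=; apply: eq_bigr => j _.
have := uE i j; rewrite mxE => ->.
rewrite mulr_suml mulr_sumr; apply: eq_bigr => k _; rewrite rmorphM /=; ring.
Qed.

(** * The Fourier-Stieltjes algebra *)

Section Character.
Variable R : realType.
Local Notation C := (cplx R).

Definition chi (k : 'Z_4) : C := ic R ^+ k.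

Lemma chi0 : chi 0 = 1. Proof. by []. Qed.

Lemma chiD k l : chi (k + l) = chi k * chi l.
Proof.
have ic4 : ic R ^+ 4 = 1 by rewrite !exprS expr0; apply: complex_ext; rewrite !ReImE; ring.
by rewrite /chi -exprD -[RHS](expr_mod _ ic4).
Qed.

Lemma modc_chi k : modc (chi k) = 1.
Proof.
have ic1 : modc (ic R) = 1.
  have := modc_sqr (ic R); rewrite Re_ic Im_ic expr0n add0r expr1n => h.
  by apply/eqP; rewrite -(@eqrXn2 _ 2) ?modc_ge0 // h expr1n.
rewrite /chi; elim: (nat_of_ord k) => [|n IH]; first by rewrite modc1.
by rewrite exprS modcM ic1 mul1r.
Qed.

Lemma chiN k : chi (- k) = (chi k)^*.
Proof.
have h : chi k * chi (- k) = 1 by rewrite -chiD subrr.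
have h' := mulJ_modc (chi k).
have nz : chi k != 0 by apply/eqP => h0; move: h; rewrite h0 mul0r => /eqP; rewrite eq_sym oner_eq0.
by apply: (mulfI nz); rewrite h h' modc_chi expr1n.
Qed.

Lemma sum_chi (s : 'Z_4) : \sum_(k : 'Z_4) chi (k * s) = if s == 0 then 4 else 0.
Proof.
case: eqP => [->|sn].
  rewrite (eq_bigr (fun=> 1)) => [|k _]; last by rewrite mulr0.
  by rewrite sumr_const card_ord.
have [k0 hk] : exists k, chi (k * s) != 1.
  exists 1; rewrite mul1r; apply/eqP.
  case: s sn => -[|[|[|[|//]]]] i0 sn; first by case: sn; apply: val_inj.
  1-3: clear sn; rewrite /chi /= ?exprS ?expr0 => /(congr1 (@complex.Re R)).
  1-3: by rewrite !ReImE => ?; lra.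
apply: (mulfI (_ : 1 - chi (k0 * s) != 0)); first by rewrite subr_eq0 eq_sym.
rewrite mulr0 mulrBl mul1r mulr_sumr.
rewrite [X in X - _](reindex_inj (addrI k0)) /=.
apply/eqP; rewrite subr_eq0; apply/eqP; apply: eq_bigr => k _.
by rewrite mulrDl chiD.
Qed.

Lemma chi_split (a : C) : exists2 c : 'Z_4 -> R,
  (forall k, 0 <= c k) & a = \sum_k chi k * rc (c k).
Proof.
pose c (k : 'Z_4) : R := nth 0 [:: Num.max 0 (complex.Re a); Num.max 0 (complex.Im a);
  Num.max 0 (- complex.Re a); Num.max 0 (- complex.Im a)] k.
exists c.
  by case=> -[|[|[|[|//]]]] ? /=; rewrite /c /= le_max lexx.
rewrite !big_ord_recl big_ord0 /chi /c /= !exprS expr0.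
apply: complex_ext; rewrite !ReImE /Num.max; do 4 case: ifP; rewrite ?oppr_gt0 ?oppr_cp0; lra.
Qed.
End Character.

Section FourierStieltjes.
Variables (R : realType) (G : topologicalZmodType).
Local Notation C := (cplx R).
Implicit Types (phi psi f g : G -> C) (K L : R).

Lemma continuous_modcP f : continuous f <->
  forall x (e : R), 0 < e -> \forall y \near x, modc (f x - f y) <= e.
Proof.
split=> [cf x e e0|h x].
  have e0' : 0 < rc e by rewrite /rc ltcR.
  have /cvgrPdist_le/(_ _ e0') := cf x; apply: filterS => y.
  by rewrite modcE lecR.
apply/cvgrPdist_le => e e0.
have [e1 e2] : 0 <= e /\ e = rc (complex.Re e) by split; [exact: ltW|exact/ge0_rc/ltW].
move: e0; rewrite e2 ltcR => e0.
by apply: filterS (h x _ e0) => y; rewrite modcE lecR.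
Qed.

(* Any function of the span can be written [phi 0 - phi 2 + i (phi 1 - phi 3)]. *)
Definition fsball K f := exists phi : 'Z_4 -> G -> C,
  [/\ forall k, continuous (phi k), forall k, positive_definite (phi k),
      forall k, complex.Re (phi k 0) <= K
    & forall x, f x = \sum_k chi R k * phi k x].

Lemma fsball_bound K f x : fsball K f -> modc (f x) <= 4 * K.
Proof.
move=> [phi [cp pd pK ->]]; apply: le_trans (modc_sum _ _ _) _.
have -> : 4 * K = \sum_(k : 'Z_4) K by rewrite sumr_const card_ord mulr_natl.
apply: ler_sum => k _; rewrite modcM modc_chi mul1r.
exact: le_trans (pd_bound x (pd k)) (pK k).
Qed.

Lemma fsball_ge0 K f : fsball K f -> 0 <= K.
Proof.
by move=> /(fsball_bound 0) h; have := le_trans (modc_ge0 _) h; rewrite pmulr_rge0.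
Qed.

Lemma fsball_le K L f : K <= L -> fsball K f -> fsball L f.
Proof.
by move=> KL [phi [h1 h2 h3 h4]]; exists phi; split=> // k; exact: le_trans (h3 k) KL.
Qed.

Lemma eq_fsball K f g : (forall x, f x = g x) -> fsball K f -> fsball K g.
Proof. by move=> /funext ->. Qed.

Lemma continuous_sum (J : finType) (F : J -> G -> C) :
  (forall j, continuous (F j)) -> continuous (fun x => \sum_j F j x).
Proof.
move=> cF; apply: continuous_big => [p|j _]; [exact: add_continuous|exact: cF].
Qed.

Lemma continuous_scale (a : C) f : continuous f -> continuous (fun x => a * f x).
Proof. by move=> cf x; apply: cvgM; [exact: cvg_cst|exact: cf]. Qed.

Lemma fsball_sum (J : finType) (K : J -> R) (f : J -> G -> C) :
  (forall j, fsball (K j) (f j)) -> fsball (\sum_j K j) (fun x => \sum_j f j x).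
Proof.
move=> /choice[phi h]; exists (fun k x => \sum_j phi j k x); split.
- by move=> k; apply: continuous_sum => j; case: (h j).
- by move=> k; apply: pd_sum => j; case: (h j).
- by move=> k; rewrite Re_sum; apply: ler_sum => j _; case: (h j).
move=> x; under [RHS]eq_bigr do rewrite mulr_sumr.
by rewrite exchange_big /=; apply: eq_bigr => j _; case: (h j).
Qed.

Lemma fsball_scale (r : R) K f : 0 <= r -> fsball K f ->
  fsball (r * K) (fun x => rc r * f x).
Proof.
move=> r0 [phi [h1 h2 h3 h4]]; exists (fun k x => rc r * phi k x); split.
- by move=> k; apply: continuous_scale.
- by move=> k; apply: pd_scale; rewrite ?rc_ge0.
- by move=> k; rewrite ReM Re_rc Im_rc mul0r subr0 ler_wpM2l.
by move=> x; rewrite h4 mulr_sumr; apply: eq_bigr => k _; rewrite mulrCA.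
Qed.

(** Multiplication by a fourth root of unity only permutes the four components, hence no loss in
    [K]. *)
Lemma fsball_chi (l : 'Z_4) K f : fsball K f -> fsball K (fun x => chi R l * f x).
Proof.
move=> [phi [h1 h2 h3 h4]]; exists (fun k => phi (k - l)); split.
- by move=> k; exact: (h1 (k - l)).
- by move=> k; exact: (h2 (k - l)).
- by move=> k; exact: (h3 (k - l)).
move=> x; rewrite h4 mulr_sumr [RHS](reindex_inj (addIr l)) /=.
by apply: eq_bigr => k _; rewrite addrK mulrA chiD [chi R k * _]mulrC.
Qed.

(** The components of a product are convolutions over Z/4, four terms each; this is the factor 4. *)
Lemma fsball_mul K L f g : fsball K f -> fsball L g ->
  fsball (4 * (K * L)) (fun x => f x * g x).
Proof.
move=> [phi [h1 h2 h3 h4]] [psi [g1 g2 g3 g4]].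
exists (fun k x => \sum_l phi l x * psi (k - l) x); split.
- move=> k; apply: continuous_sum => l x; exact: (cvgM (h1 l x) (g1 (k - l) x)).
- by move=> k; apply: pd_sum => l; apply: pd_mul.
- move=> k; rewrite Re_sum.
  have -> : 4 * (K * L) = \sum_(k : 'Z_4) (K * L) by rewrite sumr_const card_ord mulr_natl.
  apply: ler_sum => l _.
  have /ge0cP[i1 r1] := pd0_ge0 (h2 l); have /ge0cP[i2 r2] := pd0_ge0 (g2 (k - l)).
  by rewrite ReM i1 mul0r subr0; apply: ler_pM.
move=> x; under [RHS]eq_bigr do rewrite mulr_sumr.
rewrite exchange_big /= h4 mulr_suml; apply: eq_bigr => l _.
rewrite g4 mulr_sumr [RHS](reindex_inj (addIr l)) /=; apply: eq_bigr => k _.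
by rewrite addrK chiD; ring.
Qed.

Lemma pd_cst (a : C) : 0 <= a -> positive_definite (fun _ : G => a).
Proof.
move=> a0 n x c.
have -> : \sum_(i < n) \sum_(j < n) c i * (c j)^* * a =
    (\sum_(i < n) c i) * (\sum_(i < n) c i)^* * a.
  rewrite rmorph_sum /= !mulr_suml; apply: eq_bigr => i _.
  by rewrite mulr_sumr mulr_suml.
by rewrite mulr_ge0 // mul_conjC_ge0.
Qed.

Lemma fsball_pd phi : continuous phi -> positive_definite phi ->
  fsball (complex.Re (phi 0)) phi.
Proof.
move=> cp pd; exists (fun k => if k == 0 then phi else fun=> 0); split.
- by move=> k; case: eqP => _; [exact: cp|move=> x; exact: cvg_cst].
- by move=> k; case: eqP => _; [exact: pd|exact: pd_cst].
- by move=> k; case: eqP => _; rewrite ?lexx // Re_0; have /ge0cP[] := pd0_ge0 pd.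
move=> x; rewrite (bigD1 0) //= big1 ?addr0 ?chi0 ?mul1r // => k /negbTE ->.
by rewrite mulr0.
Qed.

Lemma fsball_cscale (a : C) K f : fsball K f ->
  exists L, fsball L (fun x => a * f x).
Proof.
move=> fK; have [c c0 ->] := chi_split a.
exists (\sum_k c k * K).
apply: (@eq_fsball _ (fun x => \sum_k chi R k * (rc (c k) * f x))).
  by move=> x; rewrite mulr_suml; apply: eq_bigr => k _; rewrite mulrA.
by apply: fsball_sum => k; apply: fsball_chi; exact: fsball_scale.
Qed.

Lemma fsballD K L f g : fsball K f -> fsball L g ->
  fsball (K + L) (fun x => f x + g x).
Proof.
move=> fK gL.
have := @fsball_sum bool (fun b => if b then K else L) (fun b => if b then f else g).
rewrite big_bool => h.
have : fsball (K + L) (fun x => \sum_b (if b then f else g) x) by apply: h; case.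
by apply: eq_fsball => x; rewrite big_bool.
Qed.

Lemma fsball_cst (a : C) : exists L, fsball L (fun=> a).
Proof.
have h : fsball 1 (fun=> 1).
  by apply: (@fsball_pd (fun=> 1)); [move=> x; exact: cvg_cst|exact: pd_cst].
have [L hL] := fsball_cscale a h; exists L.
by apply: eq_fsball hL => x; rewrite mulr1.
Qed.

Lemma fsball_conj K f : fsball K f -> fsball K (fun x => (f x)^*).
Proof.
move=> [phi [h1 h2 h3 h4]]; exists (fun k x => (phi (- k) x)^*); split.
- move=> k; apply/continuous_modcP => x e e0.
  have /continuous_modcP/(_ x e e0) := h1 (- k).
  by apply: filterS => y; rewrite -rmorphB modcJ.
- move=> k n x c; have := h2 (- k) n (fun i => - x i) c.
  congr (0 <= _); apply: eq_bigr => i _; apply: eq_bigr => j _.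
  by rewrite -pdN // opprB [- x i + _]addrC opprK.
- by move=> k; rewrite ReJ.
move=> x; rewrite h4 rmorph_sum [RHS](reindex_inj oppr_inj) /=.
by apply: eq_bigr => k _; rewrite rmorphM opprK chiN.
Qed.

Lemma fsballP f : fourier_stieltjes f <-> exists K, fsball K f.
Proof.
split=> [[n [a [phi [h ->]]]]|[K [phi [h1 h2 h3 h4]]]].
  have : forall i, exists L, fsball L (fun x => a i * phi i x).
    by move=> i; case: (h i) => ? ?; apply: fsball_cscale; exact: fsball_pd.
  by move=> /choice[L hL]; exists (\sum_i L i); exact: fsball_sum.
by exists 4%N, (chi R), phi; split=> //; apply/funext => x; exact: h4.
Qed.

(** Krein's inequality turns continuity of the components at 0 into uniform continuity. *)
Lemma fsball_unif K f (e : R) : fsball K f -> 0 < e ->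
  \forall v \near (0 : G), forall x, modc (f (x + v) - f x) <= e.
Proof.
move=> [phi [h1 h2 h3 h4]] e0.
have K0 : 0 <= K by have /ge0cP[_] := pd0_ge0 (h2 0) => /le_trans; apply.
(* Krein bounds the squared increment of a component by 2 K d, which is at most (e / 4)^2; the + 1
   avoids dividing by 0. *)
pose d := (e / 4) ^+ 2 / (2 * K + 1).
have d0 : 0 < d by rewrite divr_gt0 ?exprn_gt0 //; lra.
have near_phi k : \forall v \near (0 : G), modc (phi k 0 - phi k v) <= d.
  by have /continuous_modcP := h1 k; apply.
have : \forall v \near (0 : G), forall k, modc (phi k 0 - phi k v) <= d.
  by apply: filter_forall => k; exact: near_phi.
apply: filterS => v hv x; rewrite !h4 -sumrB.
apply: le_trans (modc_sum _ _ _) _.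
have -> : e = \sum_(k : 'Z_4) (e / 4).
  have e4 : e / 4 * 4 = e by rewrite divfK ?pnatr_eq0.
  by rewrite sumr_const card_ord -[LHS]e4 mulr_natr.
apply: ler_sum => k _; rewrite -mulrBr modcM modc_chi mul1r.
have e40 : 0 <= e / 4 by rewrite divr_ge0 // ltW.
rewrite -ler_sqr ?nnegrE ?modc_ge0 //.
apply: le_trans (pd_krein _ _ (h2 k)) _; rewrite addrAC subrr add0r.
have /ge0cP[_ p0] := pd0_ge0 (h2 k).
have : complex.Re (phi k 0) - complex.Re (phi k v) <= d.
  by have := le_trans (Re_le_modc _) (hv k); rewrite !ReImE ler_norml => /andP[].
have -> : (e / 4) ^+ 2 = (2 * K + 1) * d by rewrite /d [RHS]mulrC divfK // gt_eqF //; lra.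
have := h3 k; nra.
Qed.

End FourierStieltjes.

(** * Positive linear functionals and means *)

Section PositiveLinear.
Variables (R : realType) (X : Type).
Local Notation C := (cplx R).
Implicit Types (D : set (X -> C)) (L : (X -> C) -> C) (f g : X -> C).

(** Closure under domination stands in for measurability: moduli, real parts and cut-offs by
    arbitrary sets remain in the domain. Bounded functions (for means) and [bcs] (for the Haar
    integral) are the two instances. *)
Definition solid D :=
  [/\ D (fun=> 0), forall f g, D f -> D g -> D (fun x => f x + g x),
      forall (a : C) f, D f -> D (fun x => a * f x)
    & forall f g, D f -> (forall x, modc (g x) <= modc (f x)) -> D g].

Definition positive_linear D L :=
  [/\ forall f g, D f -> D g -> L (fun x => f x + g x) = L f + L g,
      forall (a : C) f, D f -> L (fun x => a * f x) = a * L f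
    & forall f, D f -> (forall x, 0 <= f x) -> 0 <= L f].

Variables (D : set (X -> C)) (L : (X -> C) -> C).
Hypotheses (sD : solid D) (pL : positive_linear D L).

Lemma plD f g : D f -> D g -> L (fun x => f x + g x) = L f + L g.
Proof. by case: pL => h _ _; apply: h. Qed.

Lemma plZ a f : D f -> L (fun x => a * f x) = a * L f.
Proof. by case: pL => _ h _; apply: h. Qed.

Lemma plge0 f : D f -> (forall x, 0 <= f x) -> 0 <= L f.
Proof. by case: pL => _ _; apply. Qed.

Lemma solid0 : D (fun=> 0). Proof. by case: sD. Qed.
Lemma solidD f g : D f -> D g -> D (fun x => f x + g x).
Proof. by case: sD => _ h _ _; apply: h. Qed.
Lemma solidZ a f : D f -> D (fun x => a * f x).
Proof. by case: sD => _ _ h _; apply: h. Qed.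
Lemma solid_le f g : D f -> (forall x, modc (g x) <= modc (f x)) -> D g.
Proof. by case: sD => _ _ _ h; apply: h. Qed.

Lemma solidB f g : D f -> D g -> D (fun x => f x - g x).
Proof.
move=> Df Dg; have := solidD Df (solidZ (-1) Dg).
by rewrite (_ : (fun x => f x + -1 * g x) = (fun x => f x - g x)) //;
   apply/funext => x; rewrite mulN1r.
Qed.

Lemma plB f g : D f -> D g -> L (fun x => f x - g x) = L f - L g.
Proof.
move=> Df Dg; rewrite -[X in _ + X]mulN1r -plZ // -plD //; last exact: solidZ.
by congr L; apply/funext => x; rewrite mulN1r.
Qed.

Lemma pl0 : L (fun=> 0) = 0.
Proof.
rewrite -[RHS](mul0r (L (fun=> 0))) -(plZ 0 solid0).
by congr L; apply/funext => x; rewrite mul0r.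
Qed.

Lemma solid_sum (J : Type) (s : seq J) (F : J -> X -> C) :
  (forall j, D (F j)) -> D (fun x => \sum_(j <- s) F j x).
Proof.
move=> DF; elim: s => [|j s IH].
  by rewrite (_ : (fun x => _) = (fun=> 0)); [exact: solid0|apply/funext => x; rewrite big_nil].
rewrite (_ : (fun x => _) = (fun x => F j x + \sum_(j <- s) F j x)); first exact: solidD.
by apply/funext => x; rewrite big_cons.
Qed.

Lemma pl_sum (J : Type) (s : seq J) (F : J -> X -> C) : (forall j, D (F j)) ->
  L (fun x => \sum_(j <- s) F j x) = \sum_(j <- s) L (F j).
Proof.
move=> DF; elim: s => [|j s IH].
  by rewrite big_nil -[RHS]pl0; congr L; apply/funext => x; rewrite big_nil.
rewrite big_cons -IH -plD //; last exact: solid_sum.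
by congr L; apply/funext => x; rewrite big_cons.
Qed.

Lemma solid_mod f : D f -> D (fun x => rc (modc (f x))).
Proof. by move=> Df; apply: (solid_le Df) => x; rewrite modc_rc ger0_norm ?modc_ge0. Qed.

Lemma pl_le (u v : X -> R) : D (rc \o u) -> D (rc \o v) -> (forall x, u x <= v x) ->
  complex.Re (L (rc \o u)) <= complex.Re (L (rc \o v)).
Proof.
move=> Du Dv uv.
have : 0 <= L (fun x => rc (v x) - rc (u x)).
  by apply: plge0 => [|x]; [exact: solidB|rewrite -rcB rc_ge0 subr_ge0].
by rewrite plB // => /ge0cP[_]; rewrite !ReImE subr_ge0.
Qed.

Lemma pl_real (u : X -> R) : D (rc \o u) -> complex.Im (L (rc \o u)) = 0.
Proof.
move=> Du.
have Dm : D (rc \o (fun x => `|u x|)).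
  by apply: (solid_le Du) => x /=; rewrite !modc_rc normr_id.
have /ge0cP[h1 _] : 0 <= L (rc \o (fun x => `|u x|)).
  by apply: plge0 => // x; rewrite rc_ge0.
have /ge0cP[h2 _] : 0 <= L (fun x => rc `|u x| - rc (u x)).
  by apply: plge0 => [|x]; [exact: solidB|rewrite -rcB rc_ge0 subr_ge0 ler_norm].
by move: h2; rewrite plB // !ImD ImN h1 sub0r => /eqP; rewrite oppr_eq0 => /eqP.
Qed.

Lemma pl_modc f : D f -> modc (L f) <= complex.Re (L (fun x => rc (modc (f x)))).
Proof.
move=> Df; have [->|Lf0] := eqVneq (L f) 0.
  rewrite modc0; have /ge0cP[] // : 0 <= L (fun x => rc (modc (f x))).
  by apply: plge0 => [|x]; [exact: solid_mod|rewrite rc_ge0 modc_ge0].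
have m0 : modc (L f) != 0 by apply: contra_neq Lf0 => /modc_eq0.
(* The phase [z] makes [L (z f)] equal to |L f|, so only the real part of [z f], at most |f|, has to
   be integrated. *)
pose z : C := (L f)^* * rc (modc (L f))^-1.
have z1 : modc z = 1.
  by rewrite modcM modcJ modc_rc ger0_norm ?invr_ge0 ?modc_ge0 // mulfV.
have zL : L (fun x => z * f x) = rc (modc (L f)).
  rewrite plZ // /z mulrAC mulrC [X in _ * X]mulrC mulJ_modc -rcM; congr rc.
  by rewrite expr2 mulKf.
have DRe (h : X -> C) : D h -> D (rc \o (fun x => complex.Re (h x))).
  by move=> Dh; apply: (solid_le Dh) => x /=; rewrite modc_rc Re_le_modc.
have DIm (h : X -> C) : D h -> D (rc \o (fun x => complex.Im (h x))).
  move=> Dh; apply: (solid_le Dh) => x /=.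
  by rewrite modc_rc -ler_sqr ?nnegrE ?modc_ge0 // real_normK ?num_real // modc_sqr lerDr sqr_ge0.
have Dz := solidZ z Df.
have -> : modc (L f) = complex.Re (L (rc \o (fun x => complex.Re (z * f x)))).
  have : L (fun x => z * f x) = L (rc \o (fun x => complex.Re (z * f x))) +
      ic R * L (rc \o (fun x => complex.Im (z * f x))).
    rewrite -plZ; last exact: DIm. rewrite -plD; [|exact: DRe|exact/solidZ/DIm].
    congr L; apply/funext => x; apply: complex_ext; rewrite /= !ReImE; ring.
  rewrite zL => /(congr1 (@complex.Re R)); rewrite Re_rc ReD ReM Re_ic Im_ic => ->.
  rewrite pl_real; last exact: DIm.
  by rewrite mul0r mul1r subr0 addr0.
apply: pl_le; [exact: DRe|exact: solid_mod|move=> x].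
apply: le_trans (ler_norm _) _; apply: le_trans (Re_le_modc _) _.
by rewrite modcM z1 mul1r.
Qed.

End PositiveLinear.

Section Means.
Variables (R : realType).
Local Notation C := (cplx R).

Definition bounded_fun (X : Type) : set (X -> C) :=
  [set f | exists M : R, forall x, modc (f x) <= M].

Lemma solid_bounded (X : Type) : solid (@bounded_fun X).
Proof.
split.
- by exists 0 => x; rewrite modc0.
- move=> f g [M hM] [N hN]; exists (M + N) => x.
  by apply: le_trans (modcD _ _) _; apply: lerD.
- move=> a f [M hM]; exists (modc a * M) => x.
  by rewrite modcM ler_wpM2l ?modc_ge0.
- by move=> f g [M hM] h; exists M => x; exact: le_trans (h x) (hM x).
Qed.

Lemma ultra_cvg (I : Type) (W : set_system I) (u : I -> R) (M : R) :
  UltraFilter W -> (forall i, `|u i| <= M) -> exists l : R, u @ W --> l.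
Proof.
move=> UW uM.
have UF : UltraFilter (u @ W).
  split; first exact: fmap_proper_filter.
  move=> H PH sub; rewrite eqEsubset; split=> // A HA /=.
  have [//|nA] := in_ultra_setVsetC (u @^-1` A) UW.
  have : H (~` A) by apply: sub.
  by move=> HnA; case: (@filter_not_empty _ H PH); rewrite -(setICr A); exact: filterI.
have := @segment_compact R (- M) M; rewrite compact_ultra => /(_ (u @ W) UF).
case=> [|l [_ hl]]; last by exists l.
by apply: (@filterE _ W) => i; rewrite /= in_itv /= -ler_norml.
Qed.

(** [L] is the limit along an ultrafilter finer than [F]; the last clause lets what holds eventually
    along [F] be treated as holding everywhere. *)
Lemma ultra_mean (I : Type) (F : set_system I) : ProperFilter F ->
  exists L : (I -> C) -> C,
    [/\ positive_linear (@bounded_fun I) L, forall a, L (fun=> a) = a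
      & forall f g, (\forall i \near F, f i = g i) -> L f = L g].
Proof.
move=> PF; have [W [UW FW]] := ultraFilterLemma PF.
pose L (f : I -> C) : C := (lim (complex.Re (f i) @[i --> W]) +i*
                            lim (complex.Im (f i) @[i --> W]))%C.
have cRe f : bounded_fun f -> complex.Re (f i) @[i --> W] --> complex.Re (L f).
  move=> [M hM]; have [|l hl] := @ultra_cvg _ W (fun i => complex.Re (f i)) M UW.
    by move=> i; exact: le_trans (Re_le_modc _) (hM i).
  by rewrite /L /= (cvg_lim _ hl).
have cIm f : bounded_fun f -> complex.Im (f i) @[i --> W] --> complex.Im (L f).
  move=> [M hM]; have [|l hl] := @ultra_cvg _ W (fun i => complex.Im (f i)) M UW.
    move=> i; apply: le_trans _ (hM i).
    rewrite -ler_sqr ?nnegrE ?modc_ge0 // real_normK ?num_real // modc_sqr.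
    by rewrite lerDr sqr_ge0.
  by rewrite /L /= (cvg_lim _ hl).
have Lu f a b : complex.Re (f i) @[i --> W] --> a -> complex.Im (f i) @[i --> W] --> b ->
    L f = (a +i* b)%C.
  by move=> ha hb; rewrite /L (cvg_lim _ ha) // (cvg_lim _ hb).
have Lnear f g : (\forall i \near F, f i = g i) -> L f = L g.
  move=> fg; have fgW : \forall i \near W, f i = g i by apply: FW.
  rewrite /L; congr (_ +i* _)%C; congr lim; rewrite eqEsubset; split=> A.
  - by move=> WA; apply: (@filterS2 _ W _ _ _ _ _ fgW WA) => i /= <-.
  - by move=> WA; apply: (@filterS2 _ W _ _ _ _ _ fgW WA) => i /= ->.
  - by move=> WA; apply: (@filterS2 _ W _ _ _ _ _ fgW WA) => i /= <-.
  - by move=> WA; apply: (@filterS2 _ W _ _ _ _ _ fgW WA) => i /= ->.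
exists L; split=> //; last first.
  move=> a; rewrite (Lu _ (complex.Re a) (complex.Im a)); [|exact: cvg_cst..].
  by case: a.
split.
- move=> f g bf bg; rewrite (Lu _ (complex.Re (L f) + complex.Re (L g))
    (complex.Im (L f) + complex.Im (L g))) //.
    by under eq_cvg do rewrite ReD; apply: cvgD; exact: cRe.
  by under eq_cvg do rewrite ImD; apply: cvgD; exact: cIm.
- move=> a f bf; rewrite (Lu _ (complex.Re (a * L f)) (complex.Im (a * L f))) //.
  + by case: (a * L f).
  + rewrite ReM; under eq_cvg do rewrite ReM.
    by apply: cvgB; (apply: cvgM; [exact: cvg_cst|]); [exact: cRe|exact: cIm].
  + rewrite ImM; under eq_cvg do rewrite ImM.
    by apply: cvgD; (apply: cvgM; [exact: cvg_cst|]); [exact: cIm|exact: cRe].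
- move=> f bf f0; apply/ge0cP; split.
    have -> : L f = L (fun i => rc (complex.Re (f i))).
      by congr L; apply/funext => i; exact: ge0_rc.
    by rewrite (Lu _ (complex.Re (L f)) 0) //=; [exact: cRe|exact: cvg_cst].
  rewrite /L /=; apply: limr_ge; first by apply/cvg_ex; eexists; exact: (cRe _ bf).
  by apply: (@filterE _ W) => i; have /ge0cP[] := f0 i.
Qed.

Lemma mean_le (I : Type) (F : set_system I) (L : (I -> C) -> C) (f : I -> C)
    (a : C) (e : R) : Filter F -> positive_linear (@bounded_fun I) L ->
  (forall b, L (fun=> b) = b) ->
  (forall f g, (\forall i \near F, f i = g i) -> L f = L g) ->
  (\forall i \near F, modc (f i - a) <= e) -> 0 <= e -> modc (L f - a) <= e.
Proof.
move=> FF pL L1 Ln fe e0; have sD := @solid_bounded I.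
(* Resetting [f] to [a] where the estimate fails does not change [L f] and makes the estimate
   global. *)
pose g i := if modc (f i - a) <= e then f i else a.
have ge i : modc (g i - a) <= e by rewrite /g; case: ifP => //; rewrite subrr modc0.
have -> : L f = L g by apply: Ln; apply: filterS fe => i; rewrite /g => ->.
have bga : bounded_fun (fun i => g i - a) by exists e.
have bg : bounded_fun g.
  exists (e + modc a) => i; rewrite -[g i](subrK a).
  by apply: le_trans (modcD _ _) _; rewrite lerD2r.
have bc (b : C) : bounded_fun (fun _ : I => b) by exists (modc b).
rewrite -[X in modc (_ - X)](L1 a) -(plB sD pL) //.
apply: le_trans (pl_modc sD pL bga) _.
rewrite -[leRHS](Re_rc e) -[X in _ <= complex.Re X](L1 (rc e)).
apply: (pl_le sD pL (u := fun i => modc (g i - a)) (v := fun=> e)) => //.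
  exact: solid_mod.
exact: bc.
Qed.

End Means.

Lemma ler_sum_cst (R : realDomainType) n (F : 'I_n -> R) (c : R) :
  (forall i, F i <= c) -> \sum_(i < n) F i <= n%:R * c.
Proof.
move=> Fc; apply: le_trans (ler_sum _ (fun i _ => Fc i)) _.
by rewrite sumr_const card_ord mulr_natl.
Qed.

(** * Invariant means on Abelian groups *)

Section InvariantMean.
Variables (R : realType) (G : zmodType).
Local Notation C := (cplx R).
Implicit Types (u v : G -> C) (l : seq G) (N : nat).

(** The average of [u] over the combinations of the entries of [l] with coefficients from 0 to N.
    Such boxes are asymptotically invariant (Følner) as N grows. *)
Fixpoint box_avg l N u : C :=
  if l is g :: l' then
    rc N.+1%:R^-1 * \sum_(n < N.+1) box_avg l' N (fun x => u (x + g *+ n))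
  else u 0.

Lemma box_avgD l N u v :
  box_avg l N (fun x => u x + v x) = box_avg l N u + box_avg l N v.
Proof.
elim: l u v => //= g l IH u v; rewrite -mulrDr -big_split /=.
by congr (_ * _); apply: eq_bigr => n _; rewrite IH.
Qed.

Lemma box_avgZ l N a u : box_avg l N (fun x => a * u x) = a * box_avg l N u.
Proof.
elim: l u => //= g l IH u; rewrite mulrCA [a * _]mulr_sumr; congr (_ * _).
by apply: eq_bigr => n _; rewrite IH.
Qed.

Lemma box_avg_ge0 l N u : (forall x, 0 <= u x) -> 0 <= box_avg l N u.
Proof.
elim: l u => //= g l IH u u0; apply: mulr_ge0; first by rewrite rc_ge0 invr_ge0.
by apply: sumr_ge0 => n _; apply: IH.
Qed.

Lemma rc_nat n : rc (n%:R : R) = n%:R. Proof. exact: (rmorph_nat (real_complex R)). Qed.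

Lemma box_avg_cst l N a : box_avg l N (fun=> a) = a.
Proof.
elim: l => //= g l IH; rewrite (eq_bigr (fun=> a)) => [|n _]; last exact: IH.
by rewrite sumr_const card_ord rcV rc_nat -[a *+ _]mulr_natl mulrA mulVf ?mul1r ?pnatr_eq0.
Qed.

Lemma box_avg_le l N u (M : R) : (forall x, modc (u x) <= M) ->
  modc (box_avg l N u) <= M.
Proof.
elim: l u => //= g l IH u uM; rewrite modcM modc_rc ger0_norm ?invr_ge0 //.
rewrite ler_pdivrMl //; apply: le_trans (modc_sum _ _ _) _.
by apply: ler_sum_cst => n; apply: IH => x; apply: uM.
Qed.

(** In the coordinate belonging to [g] the difference telescopes, and only the faces n = 0 and n = N
    + 1 survive, each bounded by M before division by N + 1. *)
Lemma box_avg_shift l N u g (M : R) : g \in l -> (forall x, modc (u x) <= M) ->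
  modc (box_avg l N (fun x => u (x + g)) - box_avg l N u) <= 2 * M / N.+1%:R.
Proof.
elim: l u => //= h l IH u; rewrite inE => /predU1P[<-{h}|gl] uM.
  rewrite -mulrBr -sumrB modcM modc_rc ger0_norm ?invr_ge0 // [leRHS]mulrC.
  apply: ler_wpM2l; first by rewrite invr_ge0.
  pose a n := box_avg l N (fun x => u (x + g *+ n)).
  rewrite (eq_bigr (fun n : 'I_N.+1 => a n.+1 - a n)) => [|n _]; last first.
    congr (_ - _); congr box_avg; apply/funext => x.
    by rewrite mulrSr addrA.
  rewrite -(big_mkord xpredT (fun n => a n.+1 - a n)) telescope_sumr //.
  apply: le_trans (modcD _ _) _; rewrite modcN mulr2n mulrDl !mul1r.
  by apply: lerD; apply: box_avg_le.
rewrite -mulrBr -sumrB modcM modc_rc ger0_norm ?invr_ge0 //.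
rewrite ler_pdivrMl //; apply: le_trans (modc_sum _ _ _) _.
apply: ler_sum_cst => n; have -> : (fun x => u (x + h *+ n + g)) =
  (fun x => (fun y => u (y + h *+ n)) (x + g)).
  by apply/funext => x; rewrite addrAC.
by apply: IH => // x; apply: uM.
Qed.

(** Amenability of [G] as a discrete group: an ultrafilter limit of box averages, over lists growing
    by inclusion and sides tending to infinity, turns approximate invariance into exact
    invariance. *)
Lemma invariant_mean : exists M : (G -> C) -> C,
  [/\ positive_linear (@bounded_fun R G) M, forall a, M (fun=> a) = a
    & forall u g, bounded_fun u -> M (fun x => u (x + g)) = M u].
Proof.
pose B (i : seq G * nat) : set (seq G * nat) :=
  [set j : seq G * nat | {subset i.1 <= j.1} /\ (i.2 <= j.2)%N].
pose F := filter_from setT B.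
have PF : ProperFilter F.
  apply: filter_from_proper; last by move=> i _; exists i; split.
  apply: filter_from_filter; first by exists ([::], 0%N).
  move=> i j _ _; exists (i.1 ++ j.1, maxn i.2 j.2) => // k [/= h1 h2]; split; split.
  - by move=> x xi; apply: h1; rewrite mem_cat xi.
  - by apply: leq_trans h2; exact: leq_maxl.
  - by move=> x xi; apply: h1; rewrite mem_cat xi orbT.
  - by apply: leq_trans h2; exact: leq_maxr.
have [L [pL L1 Ln]] := @ultra_mean R _ F PF.
have sD := @solid_bounded R (seq G * nat).
have bavg u : bounded_fun u -> bounded_fun (fun i : seq G * nat => box_avg i.1 i.2 u).
  by move=> [M hM]; exists M => i; apply: box_avg_le.
exists (fun u => L (fun i => box_avg i.1 i.2 u)); split.
- split.
  + move=> u v bu bv; rewrite -(plD pL); [|exact: bavg..].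
    by congr L; apply/funext => i; rewrite box_avgD.
  + move=> a u bu; rewrite -(plZ pL); last exact: bavg.
    by congr L; apply/funext => i; rewrite box_avgZ.
  + by move=> u bu u0; apply: (plge0 pL); [exact: bavg|move=> i; exact: box_avg_ge0].
- by move=> a; rewrite -[RHS]L1; congr L; apply/funext => i; rewrite box_avg_cst.
move=> u g [M hM]; apply/eqP; rewrite -subr_eq0; apply/eqP/modc_eq0.
have bu : bounded_fun u by exists M.
have bug : bounded_fun (fun x => u (x + g)) by exists M => x; exact: hM.
rewrite -(plB sD pL); [|exact: bavg..].
apply/le_anti; rewrite modc_ge0 andbT; apply/ler_addgt0Pr => e e0; rewrite add0r.
rewrite -[X in modc X]subr0; apply: (@mean_le R _ F L) => //; last exact: ltW.
have M0 : 0 <= M by exact: le_trans (modc_ge0 _) (hM 0).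
have [N hN] : exists N : nat, 2 * M / e < N%:R.
  exists (Num.bound (2 * M / e)); apply: archi_boundP.
  by rewrite divr_ge0 ?mulr_ge0 // ltW.
exists ([:: g], N) => // -[l K] [/= gl NK]; rewrite subr0.
apply: le_trans (box_avg_shift _ _ hM) _; first by apply: gl; rewrite inE.
rewrite ler_pdivrMr // -ler_pdivrMl // [leLHS]mulrC ltW // (lt_le_trans hN) //.
by rewrite ler_nat ltnW.
Qed.

End InvariantMean.

(** * Haar integral *)

Section FiniteSubsets.
Variable X : eqType.

(** Finite sets, as lists, directed by inclusion. The same filter extracts finite covers from
    compactness and governs the limit over finite parts of [T1]. *)
Definition fin_filter : set_system (seq X) :=
  filter_from setT (fun l : seq X => [set j : seq X | {subset l <= j}]).

Global Instance fin_filter_proper : ProperFilter fin_filter.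
Proof.
apply: filter_from_proper; last by move=> i _; exists i.
apply: filter_from_filter; first by exists [::].
move=> i j _ _; exists (i ++ j) => // k ij.
by split=> x xi; apply: ij; rewrite mem_cat xi ?orbT.
Qed.

Lemma fin_filter_mem x : \forall l \near fin_filter, x \in l.
Proof. by exists [:: x] => // l; apply; rewrite inE. Qed.

End FiniteSubsets.

Section TopologicalGroup.
Variable G : topologicalZmodType.
Implicit Types (U V K : set G) (x y : G).

Lemma cvg_subr x c : y - c @[y --> x] --> x - c.
Proof.
apply: (@continuous_comp G (G * G)%type G (fun y => (y, c)) (fun p => p.1 - p.2)).
  by apply: cvg_pair; [exact: cvg_id|exact: cvg_cst].
exact: sub_continuous.
Qed.

Lemma nbhs0_shift V x : nbhs 0 V -> nbhs x [set y | V (y - x)].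
Proof. by move=> V0; apply: (cvg_subr (x := x) (c := x)); rewrite subrr. Qed.

Lemma nbhs0_opp V : nbhs 0 V -> nbhs 0 [set y | V (- y)].
Proof.
by move=> V0; have := @opp_continuous G 0; rewrite /continuous_at oppr0; apply.
Qed.

Lemma nbhs0_split V : nbhs 0 V -> exists2 W, nbhs 0 W &
  forall x y, W x -> W y -> V (x + y) /\ V (x - y).
Proof.
move=> V0.
have h1 : \forall p \near (0 : G, 0 : G), V (p.1 + p.2).
  by apply: (@add_continuous G (0, 0)); rewrite /= addr0.
have h2 : \forall p \near (0 : G, 0 : G), V (p.1 - p.2).
  by apply: (@sub_continuous G (0, 0)); rewrite /= subr0.
have [[A B] /= [A0 B0] AB] := filterI h1 h2.
exists (A `&` B); first exact: filterI.
by move=> x y [Ax _] [_ By]; apply: (AB (x, y)).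
Qed.

Lemma nbhs0_symm V : nbhs 0 V -> exists2 W, nbhs 0 W &
  W `<=` V /\ forall x, W x -> W (- x).
Proof.
move=> V0; exists (V `&` [set y | V (- y)]); first exact/filterI/nbhs0_opp.
by split=> [x [] //|x [h1 h2]]; split=> //=; rewrite opprK.
Qed.

Lemma compact_translates K V : compact K -> nbhs 0 V ->
  exists l : seq G, forall x, K x -> exists2 y, y \in l & V (x - y).
Proof.
rewrite compact_near_coveringP => cK V0.
have := cK (seq G) (@fin_filter G) (fun l x => exists2 y, y \in l & V (x - y)).
case.
- move=> x Kx; exists ([set y | V (y - x)], [set l : seq G | x \in l]).
    by split; [exact: nbhs0_shift|exact: fin_filter_mem].
  by move=> [y l] /= [Vyx xl]; exists x.
by move=> l _ /(_ l) h; exists l => x Kx; apply: h.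
Qed.

End TopologicalGroup.

Section HaarIntegral.
Variables (R : realType) (G : topologicalZmodType).
Local Notation C := (cplx R).
Implicit Types (f : G -> C) (U V K : set G) (x y : G).

(* No measurability is asked for: the Haar integral below is only finitely
   additive, and is defined on all these functions. *)
Definition bcs : set (G -> C) := [set f | exists M : R, exists K,
  [/\ compact K, forall x, modc (f x) <= M & forall x, ~ K x -> f x = 0]].

Lemma solid_bcs : solid bcs.
Proof.
split.
- by exists 0, set0; split=> // [|x]; [exact: compact0|rewrite modc0].
- move=> f g [M [K [cK fM fK]]] [N [L [cL gN gL]]]; exists (M + N), (K `|` L).
  split; first exact: compactU.
    by move=> x; apply: le_trans (modcD _ _) _; apply: lerD.
  by move=> x KL; rewrite fK ?gL ?addr0 // => h; apply: KL; [right|left].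
- move=> a f [M [K [cK fM fK]]]; exists (modc a * M), K; split=> //.
    by move=> x; rewrite modcM ler_wpM2l ?modc_ge0.
  by move=> x /fK ->; rewrite mulr0.
- move=> f g [M [K [cK fM fK]]] gf; exists M, K; split=> //.
    by move=> x; exact: le_trans (gf x) (fM x).
  move=> x /fK fx; apply/modc_eq0/le_anti; rewrite modc_ge0 andbT.
  by apply: le_trans (gf x) _; rewrite fx modc0.
Qed.

Lemma bcs_shift f x : bcs f -> bcs (fun y => f (y + x)).
Proof.
move=> [M [K [cK fM fK]]]; exists M, [set y - x | y in K]; split=> //.
  apply: continuous_compact => //; apply: continuous_subspaceT => y.
  exact: cvg_subr.
by move=> y Ky; apply: fK => Kyx; apply: Ky; exists (y + x) => //; rewrite addrK.
Qed.

(** Each translate y + Q holds at most one point of [S], so the centres in [l] catch at most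
    [size l] of them. *)
Lemma separated_finite (S Q : set G) (l : seq G) :
  (forall y s t, S s -> S t -> Q (s - y) -> Q (t - y) -> s = t) ->
  exists r : seq G, [/\ uniq r, (size r <= size l)%N, forall s, s \in r -> S s
    & forall s y, S s -> y \in l -> Q (s - y) -> s \in r].
Proof.
move=> SQ; elim: l => [|y l [r [ur sr rS rP]]]; first by exists [::]; split.
have [[s [Ss Qs sr']]|no] := pselect (exists s, [/\ S s, Q (s - y) & s \notin r]).
  exists (s :: r); split=> //=; first by rewrite sr'.
    by move=> t; rewrite inE => /predU1P[->//|/rS].
  move=> t z St; rewrite !inE => /predU1P[->|zl] Qt.
    by rewrite (SQ y t s) ?eqxx.
  by rewrite (rP t z) ?orbT.
exists r; split=> //; first exact: leq_trans sr _.
move=> t z St; rewrite inE => /predU1P[->|zl] Qt; last exact: rP zl Qt.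
by apply: contra_notT no => tr; exists t.
Qed.

(** By Zorn: a point not within [U] of a maximal separated set could be added to it. Separation
    keeps the counting measure finite on compact sets, and density keeps it from vanishing. *)
Lemma maximal_separated U : U 0 -> (forall x, U x -> U (- x)) ->
  exists S : set G, (forall s t, S s -> S t -> U (s - t) -> s = t) /\
    forall x, exists2 s, S s & U (x - s).
Proof.
move=> U0 Us.
have [F FP Ftot|S [SP Smax]] := @Zorn_bigcup G
    [set S | forall s t, S s -> S t -> U (s - t) -> s = t].
  move=> s t [A FA As] [B FB Bt]; have [AB|BA] := Ftot _ _ FA FB.
    by apply: (FP _ FB) => //; exact: AB.
  by apply: (FP _ FA) => //; exact: BA.
exists S; split=> // x; apply: contrapT => nx.
have {}nx s : S s -> ~ U (x - s) by move=> Ss Ux; apply: nx; exists s.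
apply: (Smax (S `|` [set x])).
  split; first by move=> s Ss; left.
  by move=> /(_ x (or_intror erefl)) Sx; apply: (nx x) => //; rewrite subrr.
move=> s t [Ss|->] [St|->] //; first exact: SP.
- by move=> /Us; rewrite opprB => /nx; case.
- by move=> /nx; case.
Qed.

(* Averaging the counting measure of a maximal separated set over all its
   translates, by means of an invariant mean on [G], yields a Haar integral. *)
Lemma haar_integral V : nbhs 0 V -> exists I : (G -> C) -> C,
  [/\ positive_linear bcs I, forall f x, bcs f -> I (fun y => f (y + x)) = I f
    & forall f, bcs f -> (forall x, 0 <= f x) -> (forall x, V x -> 1 <= f x) ->
      1 <= I f].
Proof.
move=> V0; have [U U0 [UV Us]] := nbhs0_symm V0.
have [Q Q0 QU] := nbhs0_split U0.
have [S [Ssep Smax]] := maximal_separated (nbhs_singleton U0) Us.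
have SQ y s t : S s -> S t -> Q (s - y) -> Q (t - y) -> s = t.
  move=> Ss St Qs Qt; apply: Ssep => //.
  by have [_] := QU _ _ Qs Qt; rewrite opprB addrA subrK.
pose lam f : C := \sum_(s \in S) f s.
(* This makes [lam] a finite sum on functions supported in [K]. The number of terms is bounded
   uniformly in the translation x, so [u f] is bounded and the invariant mean applies to it. *)
have hits K : compact K -> exists n : nat, forall x, exists r : seq G,
    [/\ (size r <= n)%N, forall s, S s -> K (s + x) -> s \in r
      & forall f, (forall y, ~ K y -> f y = 0) ->
        lam (fun y => f (y + x)) = \sum_(s <- r) f (s + x)].
  move=> cK; have [l hl] := compact_translates cK Q0; exists (size l) => x.
  have [r [ur sr rS rP]] := separated_finite [seq y - x | y <- l] SQ.
  have rK s : S s -> K (s + x) -> s \in r.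
    move=> Ss /hl[y yl Qy].
    by apply: (rP s (y - x)) => //; [exact: map_f|rewrite opprB addrA].
  exists r; split=> //; first by rewrite size_map in sr.
  move=> f fK; rewrite /lam (@fsbigE _ _ _ _ _ r) //.
    rewrite big_seq_cond [RHS]big_seq; apply: eq_bigl => s.
    by case sr' : (s \in r) => //=; apply/mem_set/rS.
  move=> s Ss; apply: contraNeq => /eqP fs.
  by apply: rK => //; apply: contrapT => /fK.
pose u f x := lam (fun y => f (y + x)).
have bu f : bcs f -> bounded_fun (u f).
  move=> [M [K [cK fM fK]]]; have [n hn] := hits K cK; exists (n%:R * M) => x.
  have M0 : 0 <= M by exact: le_trans (modc_ge0 _) (fM 0).
  have [r [rn _ hr]] := hn x; rewrite /u (hr f fK).
  apply: le_trans (modc_sum _ _ _) _.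
  apply: le_trans (ler_sum _ (fun s _ => fM (s + x))) _.
  rewrite big_const_seq count_predT iter_addr_0 -[leLHS]mulr_natl.
  by apply: ler_wpM2r => //; rewrite ler_nat.
have uD f g : bcs f -> bcs g -> u (fun y => f y + g y) = (fun x => u f x + u g x).
  move=> [_ [K [cK _ fK]]] [_ [L [cL _ gL]]]; apply/funext => x; rewrite /u.
  have [n /(_ x)[r [_ rK hr]]] := hits _ (compactU cK cL).
  have fKL y : ~ (K `|` L) y -> f y = 0 by move=> KL; apply: fK => h; apply: KL; left.
  have gKL y : ~ (K `|` L) y -> g y = 0 by move=> KL; apply: gL => h; apply: KL; right.
  rewrite (hr f fKL) (hr g gKL) -big_split; apply: (hr (fun y => f y + g y)) => y KL.
  by rewrite fKL // gKL // addr0.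
have uZ a f : bcs f -> u (fun y => a * f y) = (fun x => a * u f x).
  move=> [_ [K [cK _ fK]]]; apply/funext => x; rewrite /u.
  have [n /(_ x)[r [_ rK hr]]] := hits _ cK.
  rewrite (hr f fK) mulr_sumr; apply: (hr (fun y => a * f y)) => y /fK ->.
  by rewrite mulr0.
have u0 f x : bcs f -> (forall y, 0 <= f y) -> 0 <= u f x.
  move=> [_ [K [cK _ fK]]] f0; rewrite /u.
  have [n /(_ x)[r [_ rK hr]]] := hits _ cK.
  by rewrite (hr f fK) sumr_ge0.
(* Every translate of [U] meets [S], so at least one term of the sum is at least 1. *)
have u1 f x : bcs f -> (forall y, 0 <= f y) -> (forall y, V y -> 1 <= f y) -> 1 <= u f x.
  move=> [M [K [cK fM fK]]] f0 f1; have [s Ss Us'] := Smax (- x).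
  have fs1 : 1 <= f (s + x).
    by apply/f1/UV; have := Us _ Us'; rewrite opprB opprK.
  have [n /(_ x)[r [_ rK hr]]] := hits _ cK.
  have sr : s \in r.
    by apply: rK => //; apply: contrapT => /fK fsx; move: fs1; rewrite fsx ler10.
  rewrite /u (hr f fK) (big_rem s sr) /= -[1]addr0; apply: lerD => //.
  exact: sumr_ge0.
have [Mn [pM M1 Minv]] := invariant_mean R G.
exists (fun f => Mn (u f)); split.
- split.
  + by move=> f g bf bg; rewrite uD // (plD pM); [|exact: bu..].
  + by move=> a f bf; rewrite uZ // (plZ pM); [|exact: bu].
  + by move=> f bf f0; apply: (plge0 pM) => [|x]; [exact: bu|exact: u0].
- move=> f x bf; rewrite -[RHS](Minv _ x (bu _ bf)); congr Mn; apply/funext => y.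
  by rewrite /u; congr lam; apply/funext => z; rewrite -addrA [y + x]addrC addrA addrAC -addrA [z + _]addrC.
- move=> f bf f0 f1; rewrite -subr_ge0 -[X in _ - X](M1 1).
  have sD := @solid_bounded R G.
  have b1 : bounded_fun (fun _ : G => 1 : C) by exists 1 => y; rewrite modc1.
  rewrite -(plB sD pM) //; last exact: bu.
  apply: (plge0 pM) => [|x]; last by rewrite subr_ge0 u1.
  exact: (solidB sD (bu _ bf) b1).
Qed.

End HaarIntegral.

(** * Autocorrelation and smoothing *)

Lemma continuous_unif (R : realType) (G : topologicalZmodType) (f : G -> cplx R) :
  (forall e : R, 0 < e ->
    \forall v \near (0 : G), forall x, modc (f (x + v) - f x) <= e) -> continuous f.
Proof.
move=> h; apply/continuous_modcP => x e e0.
have := nbhs0_shift x (h e e0); apply: filterS => y /(_ x).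
by rewrite [x + (y - x)]addrC subrK modcB.
Qed.

(** * Bumps and normalised kernels *)

Section HaarKernel.
Variables (R : realType) (G : topologicalZmodType).
Local Notation C := (cplx R).
Implicit Types (f phi : G -> C) (k : G -> R) (V K : set G) (I : (G -> C) -> C).

Lemma metrizable_bump V : metrizable R G -> locally_compact [set: G] -> nbhs 0 V ->
  exists k, [/\ forall x, 0 <= k x <= 2, exists2 K, compact K & forall x, ~ K x -> k x = 0,
    forall x, k x != 0 -> V x, nbhs 0 [set x | 1 <= k x]
    & forall x (e : R), 0 < e -> \forall y \near x, `|k x - k y| <= e].
Proof.
move=> [d [d0 dC dT dN]] lcG V0.
have [K KN [cK _]] := lcG 0 Logic.I.
have {}KN : nbhs 0 K by move: KN; rewrite /within /prop_near1 /=; apply: filterS => x; apply.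
have dge0 x y : 0 <= d x y.
  by have := dT x y x; rewrite (dC y x) ((d0 x x).2 erefl) -mulr2n pmulrn_lge0.
have dd x y z : `|d z x - d z y| <= d x y.
  rewrite ler_norml; have := dT z x y; have := dT z y x; rewrite (dC y x); lra.
have near_d (x : G) (e : R) : 0 < e -> \forall y \near x, d x y < e.
  by move=> e0; suff : nbhs x [set y | d x y < e] by []; rewrite dN; exists e.
have [r /= r0 rVK] : exists2 r : R, 0 < r & forall y, d 0 y < r -> V y /\ K y.
  by have : nbhs 0 (V `&` K) by [exact: filterI]; rewrite dN => -[r r0 h]; exists r.
(* A Lipschitz tent, at least 1 within r / 2 of 0 and zero from distance r on; the ball of radius r
   lies in [V] and in the compact set [K]. *)
pose k x := Num.max 0 (2 - d 0 x / (r / 2)).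
have k0 x : k x != 0 -> d 0 x < r.
  rewrite /k /Num.max; case: ifP => [|_]; last by rewrite eqxx.
  by rewrite subr_gt0 ltr_pdivrMr ?divr_gt0 // => + _; lra.
exists k; split.
- move=> x; rewrite /k /Num.max; have : 0 <= d 0 x / (r / 2).
    by rewrite divr_ge0 // ltW // divr_gt0.
  by case: ifP; lra.
- exists K => // y Ky; apply/eqP; apply: contra_notT Ky => ky.
  by have [] := rVK y (k0 y ky).
- by move=> y ky; have [] := rVK y (k0 y ky).
- have r2 : 0 < r / 2 by rewrite divr_gt0.
  apply: filterS (near_d 0 (r / 2) r2) => x dx /=; rewrite /k /Num.max; have : d 0 x / (r / 2) < 1.
    by rewrite ltr_pdivrMr ?divr_gt0 // mul1r.
  by case: ifP; lra.
move=> x e e0; have er : 0 < e * (r / 2) by rewrite mulr_gt0 ?divr_gt0.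
apply: filterS (near_d x _ er) => y dxy.
have : `|d 0 x / (r / 2) - d 0 y / (r / 2)| <= e.
  rewrite -mulrBl normrM (gtr0_norm (_ : 0 < (r / 2)^-1)) ?invr_gt0 ?divr_gt0 //.
  by rewrite ler_pdivrMr ?divr_gt0 //; apply: le_trans (dd _ _ _) (ltW dxy).
rewrite /k /Num.max !ler_norml => /andP[h1 h2].
by case: ifP; case: ifP => h3 h4; apply/andP; split; lra.
Qed.

Lemma compact_support_unif k K (e : R) : compact K -> (forall x, ~ K x -> k x = 0) ->
  (forall x (e : R), 0 < e -> \forall y \near x, `|k x - k y| <= e) -> 0 < e ->
  \forall v \near (0 : G), forall y, `|k (y + v) - k y| <= e.
Proof.
move=> + kK kc e0; rewrite compact_near_coveringP => cK.
have nearK : \forall v \near (0 : G), K `<=` (fun y => `|k (y + v) - k y| <= e).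
  apply: cK => x Kx.
  have e2 : 0 < e / 2 by rewrite divr_gt0.
  have h1 := kc x _ e2.
  have h2 : \forall p \near (x, 0 : G), `|k x - k (p.1 + p.2)| <= e / 2.
    have h1' : nbhs ((x, 0 : G).1 + (x, 0 : G).2) [set z | `|k x - k z| <= e / 2].
      by rewrite /= addr0.
    exact: (@add_continuous G (x, 0) _ h1').
  have [[A B] /= [A0 B0] AB] := h2.
  exists (A `&` (fun y => `|k x - k y| <= e / 2), B); first by split=> //; exact: filterI.
  move=> [y v] [[/= Ay yx] Bv]; have /= := AB (y, v) (conj Ay Bv).
  move: yx; rewrite !ler_norml => /andP[h3 h4] /andP[h5 h6]; apply/andP; split; lra.
pose N : set G := [set v | K `<=` (fun y => `|k (y + v) - k y| <= e)].
have N0 : nbhs 0 N by [].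
apply: (@filterS2 _ (nbhs 0) _ _ _ _ _ N0 (nbhs0_opp N0)) => v h1 h2 y.
have [Ky|nKy] := pselect (K y); first exact: h1.
have [Kyv|nKyv] := pselect (K (y + v)); last by rewrite !kK // subrr normr0 ltW.
by have := h2 _ Kyv; rewrite addrK distrC.
Qed.

Record haar_kernel V I k : Prop := HaarKernel {
  hk_pl : positive_linear (@bcs R G) I;
  hk_inv : forall f x, bcs f -> I (fun y => f (y + x)) = I f;
  hk_ge0 : forall x, 0 <= k x;
  hk_bcs : bcs (rc \o k);
  hk_supp : forall x, k x != 0 -> V x;
  hk_one : I (rc \o k) = 1;
  hk_sq : 0 < complex.Re (I (fun y => rc (k y * k y)));
  hk_unif : forall e : R, 0 < e ->
    \forall v \near (0 : G), forall y, `|k (y + v) - k y| <= e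
}.

Lemma bcs_mul f g : bcs f -> bounded_fun g -> bcs (fun y => f y * g y).
Proof.
move=> bf [M hM]; apply: (solid_le (@solid_bcs R G) (solidZ (@solid_bcs R G) (rc M) bf)) => x.
have M0 : 0 <= M by exact: le_trans (modc_ge0 _) (hM x).
by rewrite !modcM modc_rc ger0_norm // [leLHS]mulrC ler_wpM2r ?modc_ge0.
Qed.

Lemma bcs_bounded f : bcs f -> bounded_fun f.
Proof. by move=> [M [K [_ h _]]]; exists M. Qed.

Lemma haar_kernel_exists V : metrizable R G -> locally_compact [set: G] ->
  nbhs 0 V -> exists I k, haar_kernel V I k.
Proof.
move=> mG lcG V0.
have [k [k01 [K cK kK] kV k1 kc]] := metrizable_bump mG lcG V0.
(* Normalised on the set where the bump is at least 1, the integral gives both k and k^2 a value at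
   least 1; dividing by the first normalises the kernel, and the second is the denominator of
   [autocorr]. *)
have [I [pI Iinv I1]] := haar_integral R k1.
have sD := @solid_bcs R G.
have k0 x : 0 <= k x by have /andP[] := k01 x.
have bk : bcs (rc \o k).
  exists 2, K; split=> // x; first by rewrite modc_rc ger0_norm //; have /andP[] := k01 x.
  by move=> /kK /= ->.
have bkk : bcs (fun y => rc (k y * k y)).
  have -> : (fun y => rc (k y * k y)) = (fun y => (rc \o k) y * (rc \o k) y).
    by apply/funext => y; rewrite rcM.
  exact/bcs_mul/bcs_bounded.
have one_le (z : C) : 1 <= z -> z = rc (complex.Re z) /\ 1 <= complex.Re z.
  move=> z1; have z0 := le_trans ler01 z1; split; first exact: ge0_rc.
  by move: z1; rewrite {1}(ge0_rc z0) -rc1 lecR.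
have [Ik Ik1] : I (rc \o k) = rc (complex.Re (I (rc \o k))) /\ 1 <= complex.Re (I (rc \o k)).
  apply/one_le/I1 => // x; first by rewrite rc_ge0.
  by move=> h; rewrite /= -rc1 lecR.
have [_ Ikk1] : I (fun y => rc (k y * k y)) = rc (complex.Re (I (fun y => rc (k y * k y))))
    /\ 1 <= complex.Re (I (fun y => rc (k y * k y))).
  apply/one_le/I1 => // x; first by rewrite rc_ge0 mulr_ge0.
  move=> /= h; rewrite -rc1 lecR; nra.
set c := complex.Re (I (rc \o k)) in Ik Ik1.
have c0 : 0 < c by lra.
exists I, (fun x => c^-1 * k x); split=> //.
- by move=> x; rewrite mulr_ge0 // invr_ge0 ltW.
- by have := solidZ sD (rc c^-1) bk; rewrite (_ : (fun x => _) = rc \o (fun x => c^-1 * k x)) //;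
    apply/funext => x /=; rewrite rcM.
- by move=> x; rewrite mulf_eq0 negb_or => /andP[_ /kV].
- have -> : rc \o (fun x => c^-1 * k x) = (fun x => rc c^-1 * (rc \o k) x).
    by apply/funext => x /=; rewrite rcM.
  by rewrite (plZ pI) // Ik -rcM mulVf ?gt_eqF.
- have -> : (fun y => rc (c^-1 * k y * (c^-1 * k y))) = (fun x => rc (c^-1 * c^-1) * rc (k x * k x)).
    by apply/funext => x /=; rewrite -rcM; congr rc; ring.
  rewrite (plZ pI) // ReM Im_rc mul0r subr0 Re_rc; apply: mulr_gt0; last lra.
  by rewrite mulr_gt0 ?invr_gt0.
move=> e e0; have ec : 0 < c * e by rewrite mulr_gt0.
have := compact_support_unif cK kK kc ec; apply: filterS => v h y.
rewrite -mulrBr normrM gtr0_norm ?invr_gt0 // ler_pdivrMl //.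
Qed.

Section Kernel.
Variables (V : set G) (I : (G -> C) -> C) (k : G -> R).
Hypothesis hk : haar_kernel V I k.

Let sD := @solid_bcs R G.
Let pI := hk_pl hk.

Lemma hk_mul f : bounded_fun f -> bcs (fun y => rc (k y) * f y).
Proof. exact: (bcs_mul (hk_bcs hk)). Qed.

Lemma hk_diff_bcs x x' : bcs (fun y => rc `|k (y + x) - k (y + x')|).
Proof.
have := solidB sD (bcs_shift x (hk_bcs hk)) (bcs_shift x' (hk_bcs hk)).
move=> /(solid_le sD); apply => y /=.
by rewrite -rcB !modc_rc normr_id.
Qed.

(** Continuity of translation in L^1. Invariance removes x; the difference is then at most e' times
    the indicators of [K] and of a translate of [K], of total integral 2 c e'. *)
Lemma hk_l1 (e : R) : 0 < e ->
  \forall v \near (0 : G), forall x,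
    complex.Re (I (fun y => rc `|k (y + (x + v)) - k (y + x)|)) <= e.
Proof.
move=> e0; have [M [K [cK _ kK]]] := hk_bcs hk.
pose oneK y : R := if `[< K y >] then 1 else 0.
have bK : bcs (rc \o oneK).
  exists 1, K; split=> // y; rewrite /= /oneK; case: asboolP => //= _.
    by rewrite modc1.
  by rewrite modc0.
pose c := complex.Re (I (rc \o oneK)).
have c0 : 0 <= c.
  have /ge0cP[] // : 0 <= I (rc \o oneK).
  by apply: (plge0 pI) => // y; rewrite rc_ge0 /= /oneK; case: asboolP.
pose e' := e / (2 * c + 1).
have e'0 : 0 < e' by rewrite divr_gt0 // ltr_wpDl // mulr_ge0.
apply: filterS (hk_unif hk e'0) => v hv x.
pose u y : R := e' * (oneK (y + v) + oneK y).
have buE : rc \o u = (fun y => rc e' * ((rc \o oneK) (y + v) + (rc \o oneK) y)).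
  by apply/funext => y; rewrite /= rcM rcD.
have bu : bcs (rc \o u).
  by rewrite buE; apply: (solidZ sD); apply: (solidD sD) => //; exact: bcs_shift.
have -> : I (fun y => rc `|k (y + (x + v)) - k (y + x)|) =
    I (fun y => rc `|k (y + v) - k (y + 0)|).
  rewrite -(hk_inv hk x (hk_diff_bcs v 0)); congr I; apply/funext => y.
  by rewrite addr0 addrA.
have -> : e = e' * (2 * c + 1) by rewrite divfK // gt_eqF // ltr_wpDl // mulr_ge0.
apply: (@le_trans _ _ (complex.Re (I (rc \o u)))).
  apply: (pl_le sD pI (u := fun y => `|k (y + v) - k (y + 0)|)) => //.
    exact: hk_diff_bcs.
  move=> y; rewrite addr0 /u /oneK.
  have kz z : ~ K z -> k z = 0 by move=> /kK /complexI.
  case: asboolP => [_|K1]; case: asboolP => [_|K2].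
  - by apply: le_trans (hv y) _; rewrite ler_peMr ?ltW // ; lra.
  - by rewrite addr0 mulr1.
  - by rewrite add0r mulr1.
  - by rewrite !kz // subrr normr0 addr0 mulr0.
rewrite buE (plZ pI); last by apply: (solidD sD) => //; exact: bcs_shift.
rewrite (plD pI) //; last exact: bcs_shift.
rewrite (hk_inv hk) // ReM Im_rc mul0r subr0 Re_rc ReD -/c.
by apply: ler_wpM2l; [exact: ltW|lra].
Qed.

(** The convolution of [k] with its reflection, normalised at 0. It is continuous, positive definite
    and nonnegative, with support controlled by [V], and serves as the function w. *)
Definition autocorr (x : G) : C :=
  I (fun y => rc (k y * k (y + x))) / I (fun y => rc (k y * k y)).

Lemma hk_bounded x : bounded_fun (fun y => rc (k (y + x))).
Proof. exact/bcs_bounded/(bcs_shift x (hk_bcs hk)). Qed.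

Lemma hk_corr_bcs x : bcs (fun y => rc (k y * k (y + x))).
Proof.
rewrite (_ : (fun y => _) = (fun y => rc (k y) * rc (k (y + x)))).
  exact/hk_mul/hk_bounded.
by apply/funext => y; rewrite rcM.
Qed.

Let c := complex.Re (I (fun y => rc (k y * k y))).

Lemma hk_sqE : I (fun y => rc (k y * k y)) = rc c.
Proof.
apply: ge0_rc; apply: (plge0 pI) => [|x].
  by have := hk_corr_bcs 0; congr bcs; apply/funext => y; rewrite addr0.
by rewrite rc_ge0 mulr_ge0 // (hk_ge0 hk).
Qed.

Lemma hk_sqV : (rc c)^-1 = rc c^-1. Proof. by rewrite rcV. Qed.

Lemma autocorr0 : autocorr 0 = 1.
Proof.
rewrite /autocorr; under eq_fun do rewrite addr0.
rewrite hk_sqE mulfV //; apply/eqP => /(congr1 (@complex.Re R)) /=.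
by have := hk_sq hk; rewrite -/c => /[swap] ->; rewrite ltxx.
Qed.

(** By invariance the form is, up to a positive factor, the integral of |sum_i a_i k(y + x_i)|^2. *)
Lemma autocorr_pd : positive_definite autocorr.
Proof.
have c0 : 0 <= (rc c)^-1 by rewrite hk_sqV rc_ge0 invr_ge0 ltW // (hk_sq hk).
suff h : positive_definite (fun x => (rc c)^-1 * I (fun y => rc (k y * k (y + x)))).
  by move: h; congr positive_definite; apply/funext => x; rewrite /autocorr hk_sqE mulrC.
apply: pd_scale => // n x a.
pose F i j y : C := a i * (a j)^* * rc (k (y + x j) * k (y + x i)).
have bF i j : bcs (fun y => rc (k (y + x j) * k (y + x i))).
  have := bcs_shift (x j) (hk_corr_bcs (x i - x j)).
  by congr bcs; apply/funext => y; rewrite [x i - _]addrC addrA addrK.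
have -> : \sum_(i < n) \sum_(j < n) a i * (a j)^* * I (fun y => rc (k y * k (y + (x i - x j)))) =
    I (fun y => \sum_(i < n) \sum_(j < n) F i j y).
  rewrite (pl_sum sD pI); last by move=> i; apply: (solid_sum sD) => j; exact: (solidZ sD).
  apply: eq_bigr => i _; rewrite (pl_sum sD pI); last by move=> j; exact: (solidZ sD).
  apply: eq_bigr => j _; rewrite (plZ pI) //; congr (_ * _).
  rewrite -(hk_inv hk (x j) (hk_corr_bcs (x i - x j))); congr I; apply/funext => y.
  by congr (rc (_ * k _)); rewrite [x i - _]addrC addrA addrK.
apply: (plge0 pI) => [|y].
  by apply: (solid_sum sD) => i; apply: (solid_sum sD) => j; exact: (solidZ sD).
have -> : \sum_(i < n) \sum_(j < n) F i j y =
    (\sum_(i < n) a i * rc (k (y + x i))) * (\sum_(i < n) a i * rc (k (y + x i)))^*.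
  rewrite rmorph_sum mulr_suml; apply: eq_bigr => i _; rewrite mulr_sumr.
  by apply: eq_bigr => j _; rewrite [X in _ = _ * X]rmorphM /= conj_rc /F rcM; ring.
exact: mul_conjC_ge0.
Qed.

Lemma autocorr_ge0 x : 0 <= autocorr x.
Proof.
rewrite /autocorr hk_sqE mulr_ge0 //.
  by apply: (plge0 pI) => [|y]; [exact: hk_corr_bcs|rewrite rc_ge0 mulr_ge0 // (hk_ge0 hk)].
by rewrite hk_sqV rc_ge0 invr_ge0 ltW // (hk_sq hk).
Qed.

Lemma autocorr_supp x : autocorr x != 0 -> exists2 y, V y & V (y + x).
Proof.
apply: contra_neqP => no; rewrite /autocorr (_ : (fun y => _) = (fun=> 0)).
  by rewrite (pl0 sD pI) mul0r.
apply/funext => y; have [ky|ky] := eqVneq (k y) 0; first by rewrite ky mul0r.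
have [kx|kx] := eqVneq (k (y + x)) 0; first by rewrite kx mulr0.
by case: no; exists y; exact: (hk_supp hk).
Qed.

Lemma hk_avg_near f (a : C) (e : R) : bounded_fun f -> 0 <= e ->
  (forall z, V z -> modc (f z - a) <= e) ->
  modc (I (fun z => rc (k z) * f z) - a) <= e.
Proof.
move=> bf e0 fa.
have bc : bounded_fun (fun _ : G => a) by exists (modc a).
have bfa : bounded_fun (fun z => f z - a) by exact: (solidB (@solid_bounded R G)).
have -> : I (fun z => rc (k z) * f z) - a = I (fun z => rc (k z) * (f z - a)).
  rewrite -[in LHS](mulr1 a) -(hk_one hk) -(plZ pI); last exact: (hk_bcs hk).
  rewrite -(plB sD pI); [|exact: hk_mul|exact/(solidZ sD)/(hk_bcs hk)].
  by congr I; apply/funext => z /=; rewrite mulrBr [a * _]mulrC.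
apply: le_trans (pl_modc sD pI (hk_mul bfa)) _.
have -> : e = complex.Re (I (rc \o (fun z => e * k z))).
  rewrite (_ : rc \o _ = (fun z => rc e * (rc \o k) z)); last first.
    by apply/funext => z /=; rewrite rcM.
  by rewrite (plZ pI) ?(hk_one hk) ?mulr1 //; exact: (hk_bcs hk).
apply: (pl_le sD pI (u := fun z => modc (rc (k z) * (f z - a)))).
- exact/(solid_mod sD)/hk_mul.
- have := solidZ sD (rc e) (hk_bcs hk); congr bcs.
  by apply/funext => z /=; rewrite rcM.
move=> z; rewrite modcM modc_rc ger0_norm ?(hk_ge0 hk) // mulrC.
have [->|/(hk_supp hk)/fa h] := eqVneq (k z) 0; first by rewrite !mulr0.
by apply: ler_wpM2r => //; exact: (hk_ge0 hk).
Qed.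

(** Averaging over z and then over y gives [smooth f x] as the mean of f(x - y + z) against k(y)
    k(z). The opposite signs of y and z are what preserves positive definiteness. *)
Definition hk_avg f (t : G) : C := I (fun z => rc (k z) * f (t + z)).
Definition smooth f (x : G) : C := I (fun y => rc (k y) * hk_avg f (x - y)).

Lemma bounded_comp (X Y : Type) (h : X -> Y) (f : Y -> C) :
  bounded_fun f -> bounded_fun (f \o h).
Proof. by move=> [M hM]; exists M => x; exact: hM. Qed.

Lemma hk_avg_bound f (M : R) t : (forall x, modc (f x) <= M) -> modc (hk_avg f t) <= M.
Proof.
move=> fM; have M0 : 0 <= M by exact: le_trans (modc_ge0 _) (fM 0).
rewrite -[hk_avg f t]subr0; apply: hk_avg_near => //; first by exists M.
by move=> z _; rewrite subr0.
Qed.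

Lemma hk_avg_bounded f : bounded_fun f -> bounded_fun (hk_avg f).
Proof. by move=> [M hM]; exists M => t; exact: hk_avg_bound. Qed.

Lemma smooth_near f (a : C) (e : R) x : bounded_fun f -> 0 <= e ->
  (forall y z, V y -> V z -> modc (f (x - y + z) - a) <= e) ->
  modc (smooth f x - a) <= e.
Proof.
move=> bf e0 h; apply: (@hk_avg_near (fun y => hk_avg f (x - y))) => //.
  exact: (bounded_comp (fun y => x - y) (hk_avg_bounded bf)).
move=> y Vy; apply: (@hk_avg_near (fun z => f (x - y + z))) => //.
  exact: (bounded_comp (fun z => x - y + z) bf).
by move=> z; exact: h.
Qed.

Lemma smooth_sum (J : finType) (a : J -> C) (F : J -> G -> C) x :
  (forall j, bounded_fun (F j)) ->
  smooth (fun x => \sum_j a j * F j x) x = \sum_j a j * smooth (F j) x.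
Proof.
move=> bF.
have avgE t : hk_avg (fun x => \sum_j a j * F j x) t = \sum_j a j * hk_avg (F j) t.
  have bk j : bcs (fun z => rc (k z) * F j (t + z)).
    exact/hk_mul/(bounded_comp (fun z => t + z) (bF j)).
  rewrite (eq_bigr (fun j => I (fun z => a j * (rc (k z) * F j (t + z))))); last first.
    by move=> j _; rewrite (plZ pI).
  rewrite -(pl_sum sD pI); last by move=> j; exact: (solidZ sD).
  congr I; apply/funext => z; rewrite mulr_sumr; apply: eq_bigr => j _; ring.
have bk j : bcs (fun y => rc (k y) * hk_avg (F j) (x - y)).
  exact/hk_mul/(bounded_comp (fun y => x - y) (hk_avg_bounded (bF j))).
rewrite [RHS](eq_bigr (fun j => I (fun y => a j * (rc (k y) * hk_avg (F j) (x - y))))).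
  rewrite -(pl_sum sD pI); last by move=> j; exact: (solidZ sD).
  congr I; apply/funext => z; rewrite avgE mulr_sumr; apply: eq_bigr => j _; ring.
by move=> j _; rewrite (plZ pI).
Qed.

(* Invariance moves the translation from [f] to the kernel [k]. *)
Lemma smooth_equicontinuous (M e : R) : 0 <= M -> 0 < e ->
  \forall v \near (0 : G), forall f x, (forall x, modc (f x) <= M) ->
    modc (smooth f (x + v) - smooth f x) <= e.
Proof.
move=> M0 e0; have e1 : 0 < e / (M + 1) by rewrite divr_gt0 // ltr_wpDl.
apply: filterS (hk_l1 e1) => v hv f x fM.
have bf : bounded_fun f by exists M.
have bA : bounded_fun (fun y => hk_avg f (- y)).
  exact: (bounded_comp -%R (hk_avg_bounded bf)).
have sE t : smooth f t = I (fun y => rc (k (y + t)) * hk_avg f (- y)).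
  rewrite /smooth -(hk_inv hk t
    (hk_mul (bounded_comp (fun y => t - y) (hk_avg_bounded bf)))).
  by congr I; apply/funext => y; congr (_ * hk_avg f _); rewrite opprD addrCA subrr addr0.
have bs t : bcs (fun y => rc (k (y + t)) * hk_avg f (- y)).
  exact: (bcs_mul (bcs_shift t (hk_bcs hk)) bA).
rewrite !sE -(plB sD pI) //.
apply: le_trans (pl_modc sD pI (solidB sD (bs _) (bs _))) _.
apply: (@le_trans _ _ (complex.Re (I (rc \o
   (fun y => M * `|k (y + (x + v)) - k (y + x)|))))).
  apply: (pl_le sD pI (u := fun y => modc (rc (k (y + (x + v))) * hk_avg f (- y)
    - rc (k (y + x)) * hk_avg f (- y)))).
  - exact/(solid_mod sD)/(solidB sD).
  - have := solidZ sD (rc M) (hk_diff_bcs (x + v) x); congr bcs.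
    by apply/funext => y /=; rewrite rcM.
  move=> y; rewrite -mulrBl -rcB modcM modc_rc mulrC.
  by apply: ler_wpM2r => //; exact: hk_avg_bound.
rewrite (_ : rc \o _ = (fun y => rc M * rc `|k (y + (x + v)) - k (y + x)|)); last first.
  by apply/funext => y /=; rewrite rcM.
rewrite (plZ pI); last exact: hk_diff_bcs.
rewrite ReM Im_rc mul0r subr0 Re_rc.
apply: le_trans (ler_wpM2l M0 (hv x)) _.
by rewrite mulrA ler_pdivrMr ?ltr_wpDl // [M * e]mulrC ler_pM2l //; lra.
Qed.

Lemma autocorr_continuous : continuous autocorr.
Proof.
apply: continuous_unif => e e0; have c0 : 0 < c := hk_sq hk.
have ec : 0 < e * c by rewrite mulr_gt0.
apply: filterS (hk_unif hk ec) => v hv x.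
have E t : I (fun y => rc (k y * k (y + t))) = I (fun y => rc (k y) * rc (k (y + t))).
  by congr I; apply/funext => y; rewrite rcM.
rewrite /autocorr hk_sqE hk_sqV -mulrBl !E -(plB sD pI); [|exact/hk_mul/hk_bounded..].
rewrite modcM modc_rc gtr0_norm ?invr_gt0 // ler_pdivrMr //.
rewrite -[X in modc X]subr0.
rewrite (_ : (fun y => _) = (fun y => rc (k y) * (rc (k (y + (x + v))) - rc (k (y + x)))));
  last by apply/funext => y; rewrite mulrBr.
apply: hk_avg_near; [|exact: ltW|].
  by apply: (solidB (@solid_bounded R G)); exact: hk_bounded.
by move=> y _; rewrite subr0 -rcB modc_rc addrA.
Qed.

(** The mass of [h] is cut along the cover and each piece is moved to its centre. Nodes and weights
    do not depend on [f], so the same ones can discretise both averages in [smooth]. *)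
Lemma riemann_sum (W : set G) (l : seq G) (h : G -> R) :
  (forall x, 0 <= h x) -> bcs (rc \o h) ->
  (forall x, h x != 0 -> exists2 y, y \in l & W (x - y)) ->
  exists s : seq (G * R), (forall p, p \in s -> 0 <= p.2) /\
    forall f (e : R), bounded_fun f -> 0 <= e ->
      (forall x y, W (x - y) -> modc (f x - f y) <= e) ->
      modc (I (fun x => rc (h x) * f x) - \sum_(p <- s) rc p.2 * f p.1)
        <= e * complex.Re (I (rc \o h)).
Proof.
elim: l h => [|y l IH] h h0 bh hl.
  exists [::]; split=> // f e bf e0 _; rewrite big_nil.
  have -> : (fun x => rc (h x) * f x) = (fun=> 0).
    apply/funext => x; have -> : h x = 0; last by rewrite mul0r.
    by apply/eqP; apply: contraPT isT => /hl[].
  rewrite (pl0 sD pI) subr0 modc0 mulr_ge0 //.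
  have /ge0cP[] // : 0 <= I (rc \o h).
  by apply: (plge0 pI) => // x; rewrite rc_ge0.
pose h1 x := if `[< W (x - y) >] then h x else 0.
pose h2 x := if `[< W (x - y) >] then 0 else h x.
have h12 x : h x = h1 x + h2 x.
  by rewrite /h1 /h2; case: asboolP; rewrite ?addr0 ?add0r.
have h10 x : 0 <= h1 x by rewrite /h1; case: asboolP.
have h20 x : 0 <= h2 x by rewrite /h2; case: asboolP.
have bh1 : bcs (rc \o h1).
  apply: (solid_le sD bh) => x /=; rewrite !modc_rc !ger0_norm //.
  by rewrite h12 lerDl.
have bh2 : bcs (rc \o h2).
  apply: (solid_le sD bh) => x /=; rewrite !modc_rc !ger0_norm //.
  by rewrite h12 lerDr.
have [|s [s0 hs]] := IH h2 h20 bh2.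
  move=> x; rewrite /h2; case: asboolP => [_|nW]; first by rewrite eqxx.
  by move=> /hl[z]; rewrite inE => /predU1P[->//|zl Wz]; exists z.
pose m := complex.Re (I (rc \o h1)).
have Im : I (rc \o h1) = rc m.
  by apply: ge0_rc; apply: (plge0 pI) => // x; rewrite rc_ge0.
have m0 : 0 <= m by rewrite -rc_ge0 -Im; apply: (plge0 pI) => // x; rewrite rc_ge0.
exists ((y, m) :: s); split=> [p|f e bf e0 fW].
  by rewrite inE => /predU1P[->//|/s0].
have bhf (g : G -> R) : bcs (rc \o g) -> bcs (fun x => rc (g x) * f x).
  by move=> bg; exact: bcs_mul bg bf.
rewrite big_cons /=.
have -> : (fun x => rc (h x) * f x) = (fun x => rc (h1 x) * f x + rc (h2 x) * f x).
  by apply/funext => x; rewrite h12 rcD mulrDl.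
have -> : rc \o h = (fun x => (rc \o h1) x + (rc \o h2) x).
  by apply/funext => x /=; rewrite h12 rcD.
rewrite (plD pI (bhf _ bh1) (bhf _ bh2)) (plD pI bh1 bh2) ReD mulrDr opprD addrACA.
apply: le_trans (modcD _ _) _; apply: lerD; last exact: hs.
have -> : I (fun x => rc (h1 x) * f x) - rc m * f y = I (fun x => rc (h1 x) * (f x - f y)).
  rewrite -Im [_ * f y]mulrC -(plZ pI) // -(plB sD pI); [|exact: bhf|exact: (solidZ sD)].
  by congr I; apply/funext => x /=; rewrite mulrBr [f y * _]mulrC.
have bd : bcs (fun x => rc (h1 x) * (f x - f y)).
  apply: (bcs_mul bh1); apply: (solidB (@solid_bounded R G)) => //.
  by exists (modc (f y)).
apply: le_trans (pl_modc sD pI bd) _.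
have -> : e * complex.Re (I (rc \o h1)) = complex.Re (I (rc \o (fun x => e * h1 x))).
  rewrite (_ : rc \o (fun x => e * h1 x) = (fun x => rc e * (rc \o h1) x)); last first.
    by apply/funext => x /=; rewrite rcM.
  by rewrite (plZ pI) // ReM Im_rc mul0r subr0.
apply: (pl_le sD pI (u := fun x => modc (rc (h1 x) * (f x - f y)))).
- exact: (solid_mod sD).
- by have := solidZ sD (rc e) bh1; congr bcs; apply/funext => x /=; rewrite rcM.
move=> x; rewrite modcM modc_rc ger0_norm // [leRHS]mulrC /h1.
case: asboolP => [Wx|_]; last by rewrite !mul0r.
by apply: ler_wpM2l => //; exact: fW.
Qed.

(** Discretising both averages by one Riemann sum approximates [smooth phi] uniformly by functions
    of the form treated in [pd_conv], and positive definiteness passes to uniform limits. *)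
Lemma smooth_pd phi : continuous phi -> positive_definite phi ->
  positive_definite (smooth phi).
Proof.
move=> cp pd; apply: pd_closed => e e0.
have bp : bounded_fun phi by exists (complex.Re (phi 0)) => x; exact: pd_bound.
have e2 : 0 < e / 2 by rewrite divr_gt0.
have := fsball_unif (fsball_pd cp pd) e2.
move=> /nbhs0_symm[W W0 [Wphi Wsymm]].
have [M [K [cK _ kK]]] := hk_bcs hk.
have [l hl] := compact_translates cK W0.
have [|s [s0 hs]] := riemann_sum (W := W) (l := l) (hk_ge0 hk) (hk_bcs hk).
  move=> x kx; apply: hl; apply: contrapT => /kK /complexI kx0.
  by rewrite kx0 eqxx in kx.
have hs1 f (d : R) : bounded_fun f -> 0 <= d ->
    (forall x y, W (x - y) -> modc (f x - f y) <= d) ->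
    modc (I (fun x => rc (k x) * f x) - \sum_(p <- s) rc p.2 * f p.1) <= d.
  by move=> bf d0 fd; have := hs f d bf d0 fd; rewrite (hk_one hk) Re_1 mulr1.
(* For the constant function 1 the error bound is 0, so the weights sum to 1 exactly. *)
have sum1 : \sum_(p <- s) p.2 = 1.
  have b1 : bounded_fun (fun _ : G => 1 : C) by exists 1 => x; rewrite modc1.
  have := hs1 _ 0 b1 (lexx 0) _; rewrite (_ : (fun x => rc (k x) * 1) = rc \o k); last first.
    by apply/funext => x; rewrite mulr1.
  rewrite (hk_one hk) => h.
  have /modc_eq0 /eqP : modc (1 - \sum_(p <- s) rc p.2 * 1) = 0.
    by apply/le_anti; rewrite modc_ge0 andbT; apply: h => x y _; rewrite subrr modc0.
  under eq_bigr do rewrite mulr1.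
  by rewrite subr_eq0 -rc_sum => /eqP/(congr1 (@complex.Re R)) /= <-.
pose n := size s; pose P (i : 'I_n) := (nth (0, 0) s i).1.
pose m (i : 'I_n) := (nth (0, 0) s i).2.
exists (fun x => \sum_a \sum_b rc (m a) * (rc (m b))^* * phi (x - P a + P b)).
  exact: pd_conv.
move=> x.
have sumE (F : G * R -> C) : \sum_(p <- s) F p = \sum_(i < n) F (P i, m i).
  by rewrite (big_nth (0, 0)) big_mkord; apply: eq_bigr => i _; rewrite -surjective_pairing.
have m0 i : 0 <= m i by apply: s0; rewrite mem_nth.
have summ : \sum_i m i = 1.
  by rewrite -sum1 (big_nth (0, 0)) big_mkord.
have phiW t t' z : W (t - t') -> modc (phi (t + z) - phi (t' + z)) <= e / 2.
  move=> /Wphi /(_ (t' + z)); congr (modc (phi _ - _) <= _).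
  by rewrite addrC addrA subrK.
have bphi (t : G) : bounded_fun (fun z => phi (t + z)) by exact: (bounded_comp (fun z => t + z) bp).
have avgW t t' : W (t - t') -> modc (hk_avg phi t - hk_avg phi t') <= e / 2.
  move=> Wt; rewrite -(plB sD pI); [|exact: hk_mul..].
  rewrite -[X in modc X]subr0 (_ : (fun x => _) =
      (fun z => rc (k z) * (phi (t + z) - phi (t' + z)))); last first.
    by apply/funext => z; rewrite mulrBr.
  apply: hk_avg_near; [exact: (solidB (@solid_bounded R G))|exact: ltW|].
  by move=> z _; rewrite subr0; exact: phiW.
have h1 : modc (smooth phi x - \sum_(p <- s) rc p.2 * hk_avg phi (x - p.1)) <= e / 2.
  apply: (hs1 (fun y => hk_avg phi (x - y))); last 2 first.
  - exact: ltW.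
  - move=> y y' Wy; apply: avgW; rewrite opprB addrC addrA subrK.
    by rewrite -opprB; apply: Wsymm.
  exact: (bounded_comp (fun y => x - y) (hk_avg_bounded bp)).
have h2 t : modc (hk_avg phi t - \sum_(p <- s) rc p.2 * phi (t + p.1)) <= e / 2.
  apply: (hs1 (fun z => phi (t + z))) => //; first exact: ltW.
  by move=> y y' Wy; rewrite ![t + _]addrC; exact: phiW.
have -> : smooth phi x - \sum_a \sum_b rc (m a) * (rc (m b))^* * phi (x - P a + P b) =
    (smooth phi x - \sum_(p <- s) rc p.2 * hk_avg phi (x - p.1)) +
    \sum_a rc (m a) * (hk_avg phi (x - P a) - \sum_(p <- s) rc p.2 * phi (x - P a + p.1)).
  rewrite sumE -addrA; congr (_ + _).
  rewrite -sumrN -sumrN -big_split /=; apply: eq_bigr => a _.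
  rewrite mulrBr addrA addNr add0r; congr (- _).
  rewrite sumE mulr_sumr; apply: eq_bigr => b _.
  by rewrite conj_rc mulrA.
apply: le_trans (modcD _ _) _.
rewrite [leRHS]splitr; apply: lerD; first exact: h1.
apply: le_trans (modc_sum _ _ _) _.
have -> : e / 2 = \sum_a m a * (e / 2) by rewrite -mulr_suml summ mul1r.
apply: ler_sum => a _.
rewrite modcM modc_rc ger0_norm //; apply: ler_wpM2l => //; exact: h2.
Qed.

End Kernel.
End HaarKernel.

(** * Drury's construction over a finite set *)

Section FiniteFourier.
Variables (R : realType) (n : nat).
Local Notation C := (cplx R).
Local Notation dual := {ffun 'I_n -> 'Z_4}.
Implicit Types (t s : dual).

Definition pairing t s : 'Z_4 := \sum_i t i * s i.
Definition dcard : R := #|{: dual}|%:R.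

Lemma dcard_gt0 : 0 < dcard.
Proof. by rewrite ltr0n; apply/card_gt0P; exists 0. Qed.

Lemma pairingC t s : pairing t s = pairing s t.
Proof. by apply: eq_bigr => i _; rewrite mulrC. Qed.

Lemma pairingD t t' s : pairing (t + t') s = pairing t s + pairing t' s.
Proof. by rewrite -big_split; apply: eq_bigr => i _; rewrite ffunE mulrDl. Qed.

Lemma pairingN t s : pairing (- t) s = - pairing t s.
Proof. by rewrite -sumrN; apply: eq_bigr => i _; rewrite ffunE mulNr. Qed.

Lemma chi_sum (J : Type) (r : seq J) (P : pred J) (F : J -> 'Z_4) :
  chi R (\sum_(j <- r | P j) F j) = \prod_(j <- r | P j) chi R (F j).
Proof. exact: (big_morph (chi R) (@chiD R) (chi0 R)). Qed.

Lemma sum_chi_pairing s : \sum_t chi R (pairing t s) = if s == 0 then rc dcard else 0.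
Proof.
under eq_bigr do rewrite chi_sum.
rewrite -(bigA_distr_bigA (fun i k => chi R (k * s i))) /=.
case: eqP => [->|s0].
  rewrite (eq_bigr (fun=> 4)) => [|i _]; last by rewrite sum_chi ffunE eqxx.
  by rewrite prodr_const card_ord /dcard card_ffun !card_ord rc_nat natrX.
have [i si] : exists i, s i != 0.
  apply: contrapT => h; apply: s0; apply/ffunP => i; rewrite ffunE.
  by apply/eqP; apply: contra_notT h => si; exists i.
by rewrite (bigD1 i) //= sum_chi (negbTE si) mul0r.
Qed.

Definition fcoef (a : dual -> C) s : C :=
  rc dcard^-1 * \sum_t a t * chi R (- pairing t s).

Lemma parseval (a : dual -> C) :
  \sum_s modc (fcoef a s) ^+ 2 = dcard^-1 * \sum_t modc (a t) ^+ 2.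
Proof.
apply: (@rc_inj R); rewrite rcM !rc_sum.
have d0 : rc dcard != 0 :> C by apply/eqP => /complexI /eqP; rewrite gt_eqF ?dcard_gt0.
transitivity (\sum_s \sum_t \sum_t' rc dcard^-1 * rc dcard^-1 * (a t * (a t')^*) *
    chi R (pairing (t' - t) s)).
  apply: eq_bigr => s _; rewrite -mulJ_modc /fcoef conjM conj_rc mulrACA.
  rewrite rmorph_sum /= mulr_suml mulr_sumr; apply: eq_bigr => t _.
  rewrite mulr_sumr mulr_sumr; apply: eq_bigr => t' _.
  rewrite conjM -chiN opprK pairingD pairingN chiD /=; ring.
rewrite exchange_big mulr_sumr; apply: eq_bigr => t _ /=.
rewrite exchange_big /= (bigD1 t) //= [X in _ + X]big1 => [|t' tt'] /=; last first.
  under eq_bigr do rewrite pairingC.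
  by rewrite -mulr_sumr sum_chi_pairing subr_eq0 (negbTE tt') mulr0.
rewrite addr0; under eq_bigr do rewrite pairingC.
rewrite -mulr_sumr sum_chi_pairing subrr eqxx mulJ_modc rcV.
by rewrite [LHS]mulrAC divfK.
Qed.

End FiniteFourier.

(** * Riesz products and Drury's function *)

Section Drury.
Variables (R : realType) (G : topologicalZmodType) (n : nat).
Local Notation C := (cplx R).
Local Notation dual := {ffun 'I_n -> 'Z_4}.
Variables (e : 'I_n -> G) (w : G -> C) (al be : R).
Hypotheses (wpd : positive_definite w) (wc : continuous w) (w0 : w 0 = 1).
Hypotheses (al0 : 0 <= al) (be0 : 0 <= be) (albe : al ^+ 2 + be ^+ 2 = 1).
Implicit Types (t s : dual) (A B : {ffun 'I_n -> bool}) (x : G).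

Definition wt (a : bool) : R := if a then be else al.

Definition shift_of A : G := \sum_i (if A i then e i else 0).
Definition riesz_coef t A : C :=
  chi R (\sum_i t i * (A i)%:R) * rc (\prod_i wt (A i)).

(* The Riesz product [w * \prod_i (al + be t_i delta_(e i)) * (al + be t_i delta_(e i))~],
   which is positive definite in this form. *)
Definition riesz t x : C := \sum_A \sum_B
  riesz_coef t A * (riesz_coef t B)^* * w (x - shift_of A + shift_of B).

(** The Fourier coefficient at [k] of one factor of the Riesz product: al^2 + be^2 = 1 at 0, and al
    * be at 1 and -1. Thus al * be plays the part of eps. *)
Definition qwt (k : 'Z_4) : R := \sum_(a : bool) \sum_(b : bool)
  (if a%:R - b%:R == k then wt a * wt b else 0).
Definition lift_of (x : G) (k : 'Z_4) : G :=
  if k == 1 then x else if k == -1 then - x else 0.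
Definition total_shift s : G := \sum_i lift_of (e i) (s i).
Definition total_wt s : R := \prod_i qwt (s i).

Lemma riesz_pd t : positive_definite (riesz t).
Proof. exact: pd_conv. Qed.

Lemma riesz_continuous t : continuous (riesz t).
Proof.
apply: continuous_sum => A; apply: continuous_sum => B.
apply: continuous_scale.
have -> : (fun x => w (x - shift_of A + shift_of B)) =
    w \o (fun y => y - (shift_of A - shift_of B)).
  by apply/funext => y; rewrite /= opprB addrA addrAC.
by move=> x; apply: continuous_comp; [exact: cvg_subr|exact: wc].
Qed.

Lemma lift_of_diff x (a b : bool) :
  lift_of x (a%:R - b%:R) = (if a then x else 0) - (if b then x else 0).
Proof.
by case: a; case: b; rewrite /lift_of ?subr0 ?sub0r ?subrr //= ?oppr0.
Qed.

Lemma riesz_expand t x :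
  riesz t x = \sum_s chi R (pairing t s) * (rc (total_wt s) * w (x - total_shift s)).
Proof.
(* Character and shift depend on the pair (A, B) only through A - B; grouping the pairs by this
   difference makes the weights factor over the coordinates. *)
pose D A B : dual := [ffun i => (A i)%:R - (B i)%:R].
have total_wtE s : total_wt s = \sum_A \sum_B
    (if D A B == s then (\prod_i wt (A i)) * \prod_i wt (B i) else 0).
  rewrite /total_wt /qwt bigA_distr_bigA /=; apply: eq_bigr => A _.
  rewrite bigA_distr_bigA /=; apply: eq_bigr => B _.
  rewrite -big_split /=; case: eqP => [<-|h].
    by apply: eq_bigr => i _; rewrite ffunE eqxx.
  have [i si] : exists i, D A B i != s i.
    apply: contrapT => h'; apply: h; apply/ffunP => i.
    by apply/eqP; apply: contra_notT h' => si; exists i.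
  rewrite /D ffunE in si; rewrite (bigD1 i) //= (negbTE si).
  by rewrite mul0r.
transitivity (\sum_A \sum_B \sum_s (if D A B == s then
    rc ((\prod_i wt (A i)) * \prod_i wt (B i)) else 0) *
    (chi R (pairing t s) * w (x - total_shift s))).
  apply: eq_bigr => A _; apply: eq_bigr => B _.
  rewrite (bigD1 (D A B)) //= eqxx [X in _ = _ + X]big1 ?addr0; last first.
    by move=> s sD; rewrite eq_sym (negbTE sD) mul0r.
  have -> : total_shift (D A B) = shift_of A - shift_of B.
    rewrite /total_shift /shift_of -sumrB; apply: eq_bigr => i _.
    by rewrite ffunE lift_of_diff.
  have -> : pairing t (D A B) = \sum_i t i * (A i)%:R - \sum_i t i * (B i)%:R.
    rewrite /pairing -sumrB; apply: eq_bigr => i _; by rewrite ffunE mulrBr.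
  rewrite /riesz_coef conjM conj_rc -chiN chiD rcM opprB addrA addrAC /=; ring.
rewrite (eq_bigr _ (fun A _ => exchange_big _ _ _ _ _ _)) /= exchange_big /=.
apply: eq_bigr => s _; rewrite total_wtE rc_sum mulrCA mulr_suml.
apply: eq_bigr => A _; rewrite rc_sum mulr_suml; apply: eq_bigr => B _.
by case: eqP.
Qed.

Lemma qwtE k : qwt k = if k == 0 then 1 else if (k == 1) || (k == -1) then al * be else 0.
Proof.
rewrite /qwt !big_bool; case: k => -[|[|[|[|//]]]] i0 /=; rewrite /wt ?addr0 ?add0r //.
- by rewrite addrC -!expr2.
- by rewrite mulrC.
Qed.

Lemma albe_ge0 : 0 <= al * be. Proof. exact: mulr_ge0. Qed.

Lemma albe_le1 : al * be <= 1.
Proof. have := albe; have := al0; have := be0; nra. Qed.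

Lemma qwt_ge0 k : 0 <= qwt k.
Proof. by rewrite qwtE; case: ifP => // _; case: ifP => // _; exact: albe_ge0. Qed.

Lemma qwt_le1 k : qwt k <= 1.
Proof. by rewrite qwtE; case: ifP => // _; case: ifP => // _; exact: albe_le1. Qed.

Lemma qwt_neq0 k : k != 0 -> qwt k <= al * be.
Proof.
by rewrite qwtE => /negbTE ->; case: ifP => // _; exact: albe_ge0.
Qed.

Lemma total_wt_ge0 s : 0 <= total_wt s.
Proof. by apply: prodr_ge0 => i _; exact: qwt_ge0. Qed.

Definition degree s : 'Z_4 := \sum_i s i.
Definition unit_dual (j : 'I_n) : dual := [ffun i => if i == j then 1 else 0].

Lemma total_wt0 : total_wt 0 = 1.
Proof. by rewrite /total_wt big1 // => i _; rewrite ffunE qwtE. Qed.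

Lemma total_shift0 : total_shift 0 = 0.
Proof. by rewrite /total_shift big1 // => i _; rewrite ffunE. Qed.

Lemma total_wt_unit j : total_wt (unit_dual j) = al * be.
Proof.
rewrite /total_wt (bigD1 j) //= ffunE eqxx qwtE /= big1 ?mulr1 // => i /negbTE ij.
by rewrite ffunE ij qwtE.
Qed.

Lemma total_shift_unit j : total_shift (unit_dual j) = e j.
Proof.
rewrite /total_shift (bigD1 j) //= ffunE eqxx big1 ?addr0 // => i /negbTE ij.
by rewrite ffunE ij.
Qed.

(** A single nonzero entry must be the degree itself, that is 1. Two nonzero entries already
    contribute al * be each, and the other factors are at most 1. *)
Lemma total_wt_degree1 s : degree s = 1 ->
  (exists j, s = unit_dual j) \/ total_wt s <= (al * be) ^+ 2.
Proof.
move=> s1.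
have [i si] : exists i, s i != 0.
  apply: contrapT => h; move: s1; rewrite /degree big1 => [/eqP//|i _].
  by apply/eqP; apply: contra_notT h => si; exists i.
have [[j [ji sj]]|no] := pselect (exists j, j != i /\ s j != 0); last first.
  left; exists i; apply/ffunP => j; rewrite ffunE; case: eqP => [->|/eqP ji].
    rewrite -s1 /degree (bigD1 i) //= big1 ?addr0 // => k ki.
    by apply/eqP; apply: contra_notT no => sk; exists k.
  by apply/eqP; apply: contra_notT no => sj; exists j.
right; rewrite /total_wt (bigD1 i) //= (bigD1 j) //= expr2.
apply: ler_pM; [exact: qwt_ge0| |exact: qwt_neq0|].
  by rewrite mulr_ge0 ?qwt_ge0 // prodr_ge0 // => k _; exact: qwt_ge0.
rewrite -[al * be]mulr1; apply: ler_pM; [exact: qwt_ge0| |exact: qwt_neq0|].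
  by apply: prodr_ge0 => k _; exact: qwt_ge0.
by apply: prodr_ile1 => k _; rewrite qwt_ge0 qwt_le1.
Qed.

(** Summing over [t] keeps only the constant coefficient, which is w(0) = 1. Since [riesz t 0]
    bounds the norm of [riesz t], this is the source of estimates independent of the finite set. *)
Lemma sum_riesz0 : \sum_t complex.Re (riesz t 0) = dcard R n.
Proof.
rewrite -Re_sum; under eq_bigr do rewrite riesz_expand.
rewrite exchange_big /= (bigD1 (0 : dual)) //= [X in _ + X]big1 => [|s s0].
  rewrite addr0 -mulr_suml sum_chi_pairing eqxx total_wt0 total_shift0 subrr w0.
  by rewrite rc1 !mulr1.
by rewrite -mulr_suml sum_chi_pairing (negbTE s0) mul0r.
Qed.

Variables (phi : dual -> G -> C) (K : R).
Hypothesis phiK : forall t, fsball K (phi t).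
Hypothesis albe_gt0 : 0 < al * be.

Definition diag (k : 'Z_4) : dual := [ffun => k].
Let N := dcard R n.

(** The sum over [k] projects onto degree 1, those over [t] and [t'] each produce a Fourier
    coefficient, and division by al * be restores weight 1 to the singletons. *)
Definition drury x : C := rc ((al * be)^-1 * (N^-1 * N^-1 * 4^-1)) *
  \sum_(t : dual) \sum_(t' : dual) \sum_(k : 'Z_4)
    chi R (- k) * (phi t x * phi t' x * riesz (diag k - t - t') x).

(** Two products cost 16 K^2 times the value of the Riesz product at 0. These values sum to N over
    [t'], and the sums over [t] and [k] contribute 4 N; the normalisation cancels everything but al
    * be. *)
Lemma fsball_drury : fsball (16 * K ^+ 2 / (al * be)) drury.
Proof.
have N0 : 0 < N := dcard_gt0 R n.
have K0 : 0 <= K := fsball_ge0 (phiK 0).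
pose r t := complex.Re (riesz t 0).
have h : fsball (\sum_(t : dual) \sum_(t' : dual) \sum_(k : 'Z_4) (4 * (4 * (K * K) * r (diag k - t - t'))))
    (fun x => \sum_(t : dual) \sum_(t' : dual) \sum_(k : 'Z_4)
    chi R (- k) * (phi t x * phi t' x * riesz (diag k - t - t') x)).
  apply: fsball_sum => t; apply: fsball_sum => t'; apply: fsball_sum => k.
  apply: fsball_chi; apply: fsball_mul; first exact: fsball_mul.
  by apply: fsball_pd; [exact: riesz_continuous|exact: riesz_pd].
have ab0 : 0 <= (al * be)^-1 * (N^-1 * N^-1 * 4^-1).
  by rewrite !mulr_ge0 // invr_ge0 ltW.
have := fsball_scale ab0 h; apply: fsball_le.
rewrite (eq_bigr (fun=> \sum_(k : 'Z_4) (16 * (K * K) * N))) => [|t _].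
  rewrite sumr_const [\sum_(k : 'Z_4) _]sumr_const card_ord.
  rewrite le_eqVlt; apply/orP; left; apply/eqP.
  rewrite -[_ *+ #|_|]mulr_natr -/(dcard R n) -/N -[_ *+ (Zp_trunc 4).+2]mulr_natr.
  have -> : (Zp_trunc 4).+2 = 4 by [].
  have := lt0r_neq0 albe_gt0; rewrite mulf_eq0 negb_or => /andP[al1 be1].
  by field; apply/and3P; split=> //; exact: lt0r_neq0 N0.
rewrite exchange_big /=; apply: eq_bigr => k _.
rewrite -!mulr_sumr; have -> : \sum_(t' : dual) r (diag k - t - t') = N.
  rewrite /N -sum_riesz0 [RHS](reindex_inj (h := fun t' => diag k - t - t')) //.
  by move=> t1 t2 /addrI /oppr_inj.
by ring.
Qed.

Lemma drury_fcoef x : drury x =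
  \sum_(s | degree s == 1) rc ((al * be)^-1 * total_wt s) * w (x - total_shift s) *
    fcoef (fun t => phi t x) s ^+ 2.
Proof.
have N0 : 0 < N := dcard_gt0 R n.
pose r s : C := rc (total_wt s) * w (x - total_shift s).
pose c s : C := \sum_t phi t x * chi R (- pairing t s).
have -> : drury x = rc ((al * be)^-1 * (N^-1 * N^-1 * 4^-1)) *
    \sum_s r s * c s ^+ 2 * \sum_(k : 'Z_4) chi R (k * (degree s - 1)).
  rewrite /drury; congr (_ * _).
  transitivity (\sum_(t : dual) \sum_(t' : dual) \sum_(k : 'Z_4) \sum_(s : dual)
    r s * (phi t x * chi R (- pairing t s)) * (phi t' x * chi R (- pairing t' s)) *
    chi R (k * (degree s - 1))).
    apply: eq_bigr => t _; apply: eq_bigr => t' _; apply: eq_bigr => k _.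
    rewrite riesz_expand !mulr_sumr; apply: eq_bigr => s _.
    rewrite 2!pairingD !pairingN.
    have -> : pairing (diag k) s = k * degree s.
      by rewrite /pairing /degree mulr_sumr; apply: eq_bigr => i _; rewrite ffunE.
    rewrite mulrBr mulr1 !chiD /r; ring.
  under eq_bigr do under eq_bigr do rewrite exchange_big /=.
  under eq_bigr do rewrite exchange_big /=.
  rewrite exchange_big /=; apply: eq_bigr => s _.
  under eq_bigr do under eq_bigr do rewrite -mulr_sumr.
  under eq_bigr do rewrite -mulr_suml -mulr_sumr.
  by rewrite -!mulr_suml -mulr_sumr -/(c s) expr2 mulrA.
rewrite mulr_sumr [RHS]big_mkcond /=; apply: eq_bigr => s _.
rewrite sum_chi subr_eq0; case: eqP => _; last by rewrite !mulr0.
rewrite /fcoef -/N -/(c s) exprMn /r !rcM.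
have -> : rc 4^-1 = 4^-1 :> C by rewrite rcV rc_nat.
by move: (rc (al * be)^-1) (rc N^-1) => p q; field.
Qed.

Hypothesis w1 : forall x, modc (w x) <= 1.
Variable W : set G.
Hypothesis wW : forall x, w x != 0 -> W x.

Lemma abV_ge0 : 0 <= (al * be)^-1. Proof. by rewrite invr_ge0 ltW. Qed.

(** Singletons vanish with w(x - e_j). Every other term keeps a factor at most al * be after
    normalisation, and Parseval bounds the sum of the squared coefficients by (4 K)^2. *)
Lemma drury_far x : (forall j, ~ W (x - e j)) ->
  modc (drury x) <= al * be * (4 * K) ^+ 2.
Proof.
move=> xW; rewrite drury_fcoef; apply: le_trans (modc_sum _ _ _) _.
have pars := parseval (fun t => phi t x).
apply: (@le_trans _ _ (\sum_s al * be * modc (fcoef (fun t => phi t x) s) ^+ 2)).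
  rewrite big_mkcond /=; apply: ler_sum => s _.
  have s0 : 0 <= al * be * modc (fcoef (fun t => phi t x) s) ^+ 2.
    by rewrite mulr_ge0 ?sqr_ge0 // ltW.
  case: eqP => // /total_wt_degree1[[j sj]|ws].
    rewrite sj total_shift_unit; have [->|/wW/xW//] := eqVneq (w (x - e j)) 0.
    by rewrite mulr0 mul0r modc0 -sj.
  rewrite [X in X <= _]modcM modcM modc_rc expr2 modcM -expr2.
  apply: ler_wpM2r; first exact: sqr_ge0.
  rewrite ger0_norm; last by rewrite mulr_ge0 ?total_wt_ge0 ?abV_ge0.
  rewrite -[leRHS]mulr1; apply: ler_pM; [|exact: modc_ge0| |exact: w1].
    by rewrite mulr_ge0 ?total_wt_ge0 ?abV_ge0.
  by rewrite ler_pdivrMl // -expr2.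
rewrite -mulr_sumr pars; apply: ler_wpM2l; first exact: ltW.
rewrite ler_pdivrMl ?dcard_gt0 //.
apply: le_trans (ler_sum (G := fun=> (4 * K) ^+ 2) _ _) _.
  move=> t _; rewrite ler_sqr ?nnegrE ?modc_ge0 //; first exact: fsball_bound.
  exact: le_trans (modc_ge0 _) (fsball_bound x (phiK t)).
by rewrite sumr_const -[leLHS]mulr_natl.
Qed.

(** Near e_j the functions phi_t are close to the j-th coordinate character, whose only Fourier
    coefficient is 1 at [unit_dual j]; by Parseval the error has coefficients of square sum at most
    d^2. *)
Lemma drury_near j (v : G) (d : R) : 0 <= d ->
  (forall t, modc (phi t (e j + v) - chi R (t j)) <= d) ->
  modc (drury (e j + v) - w v) <= 2 * d + d ^+ 2.
Proof.
move=> d0 hd; set x := e j + v; set u := unit_dual j.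
pose a t := phi t x - chi R (t j).
have pu t : pairing t u = t j.
  rewrite /pairing (bigD1 j) //= ffunE eqxx mulr1 big1 ?addr0 // => i /negbTE ij.
  by rewrite ffunE ij mulr0.
have fE s : fcoef (fun t => phi t x) s = (if s == u then 1 else 0) + fcoef a s.
  have -> : (if s == u then 1 else 0) = fcoef (fun t => chi R (t j)) s.
    rewrite /fcoef (eq_bigr (fun t => chi R (pairing t (u - s)))) => [|t _]; last first.
      by rewrite ![pairing t _]pairingC pairingD pairingN chiD ![pairing _ t]pairingC pu.
    rewrite sum_chi_pairing subr_eq0 eq_sym; case: eqP => _; last by rewrite mulr0.
    by rewrite -rcM mulVf // gt_eqF // dcard_gt0.
  rewrite /fcoef -mulrDr -big_split; congr (_ * _); apply: eq_bigr => t _.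
  by rewrite /= -mulrDl /a addrC subrK.
have pars : \sum_s modc (fcoef a s) ^+ 2 <= d ^+ 2.
  rewrite parseval ler_pdivrMl ?dcard_gt0 //.
  apply: le_trans (ler_sum (G := fun=> d ^+ 2) _ _) _.
    by move=> t _; rewrite ler_sqr ?nnegrE ?modc_ge0 //; exact: hd.
  by rewrite sumr_const -[leLHS]mulr_natl.
have du : degree u == 1.
  by rewrite /degree (bigD1 j) //= ffunE eqxx big1 ?addr0 // => i /negbTE ij; rewrite ffunE ij.
pose b s : C := rc ((al * be)^-1 * total_wt s) * w (x - total_shift s).
have bu : b u = w v.
  rewrite /b total_wt_unit total_shift_unit mulVf ?gt_eqF // rc1 mul1r.
  by rewrite /x [e j + v]addrC addrK.
have b1 s : degree s == 1 -> modc (b s) <= 1.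
  move=> /eqP s1; rewrite modcM modc_rc -[leRHS]mulr1; apply: ler_pM => //.
    exact: modc_ge0.
  rewrite ger0_norm; last by rewrite mulr_ge0 ?total_wt_ge0 ?abV_ge0.
  rewrite ler_pdivrMl // mulr1.
  case: (total_wt_degree1 s1) => [[i ->]|]; first by rewrite total_wt_unit.
  by move/le_trans; apply; rewrite expr2 ger_pMr // albe_le1.
have fu : modc (fcoef a u) <= d.
  rewrite -ler_sqr ?nnegrE ?modc_ge0 //; apply: le_trans pars.
  by rewrite (bigD1 u) //= lerDl sumr_ge0 // => s _; exact: sqr_ge0.
(* At [u] the squared coefficient is (1 + a_u)^2: the 1 yields w(v), the cross term is linear in the
   error, and a_u^2 joins the remaining squares. *)
have -> : drury x - w v = 2 * (b u * fcoef a u) +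
    \sum_(s | degree s == 1) b s * fcoef a s ^+ 2.
  rewrite drury_fcoef (bigD1 u) //= [in RHS](bigD1 u) //= -/(b u) fE eqxx bu.
  rewrite (eq_bigr (fun s => b s * fcoef a s ^+ 2)) => [|s /andP[_ /negbTE su]].
    by ring.
  by rewrite fE su add0r.
apply: le_trans (modcD _ _) _; apply: lerD.
  have -> : 2 = rc 2 :> C by rewrite rc_nat.
  rewrite modcM modc_rc ger0_norm // ler_pM2l // modcM.
  rewrite -[leRHS]mul1r; apply: ler_pM; rewrite ?modc_ge0 //; exact: b1.
apply: le_trans (modc_sum _ _ _) _; apply: le_trans pars.
rewrite big_mkcond /=; apply: ler_sum => s _; case: ifP => s1; last exact: sqr_ge0.
rewrite modcM expr2 [modc (_ * _)]modcM -expr2 -[leRHS]mul1r.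
by apply: ler_pM; rewrite ?modc_ge0 ?sqr_ge0 //; exact: b1.
Qed.

End Drury.

(** * Passage to infinite sets *)

Section UniformInterpolation.
Variables (R : realType) (G : topologicalZmodType).
Local Notation C := (cplx R).

(* Gliding hump: otherwise one could glue unrealisable patterns on successive
   disjoint finite sets into one pattern on [T] that no function of the span
   realises. *)
Lemma uniform_interpolation (T : set G) (d : R) : metrizable R G ->
  interpolation_set (@fourier_stieltjes R G) T -> 0 < d ->
  exists (n : nat) (F0 : seq G) (V : set G), nbhs 0 V /\
    forall (F : seq G) (th : G -> 'Z_4),
      (forall x, x \in F -> T x /\ x \notin F0) ->
      exists phi : G -> C, [/\ fsball n%:R phi,
        forall x, x \in F -> phi x = chi R (th x)
        & forall v x, V v -> modc (phi (x + v) - phi x) <= d].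
Proof.
move=> [D [_ _ _ DN]] Tint d0.
(* A countable base at 0. One integer [n] measures both the norm and the modulus of continuity in
   [level], so a single sequence of bad patterns defeats both. *)
pose V (n : nat) : set G := [set v | D 0 v < n.+1%:R^-1].
have V0 n : nbhs 0 (V n) by rewrite DN; exists n.+1%:R^-1 => //=; rewrite invr_gt0.
pose level n phi := fsball n%:R phi /\
  forall v x, V n v -> modc (phi (x + v) - phi x) <= d.
apply: contrapT => no.
have bad (p : nat * seq G) : exists q : seq G * (G -> 'Z_4),
    (forall x, x \in q.1 -> T x /\ x \notin p.2) /\
    forall phi, level p.1 phi -> ~ forall x, x \in q.1 -> phi x = chi R (q.2 x).
  apply: contrapT => nq; apply: no; exists p.1, p.2, (V p.1); split=> // F th Fth.
  apply: contrapT => nphi; apply: nq; exists (F, th); split=> //= phi [b1 b2] b3.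
  by apply: nphi; exists phi; split.
have [B BP] := choice bad.
pose fix acc n : seq G := if n is m.+1 then (B (m, acc m)).1 ++ acc m else [::].
pose F n := (B (n, acc n)).1; pose th n := (B (n, acc n)).2.
have FT n x : x \in F n -> T x by move=> /(BP (n, acc n)).1[].
have accF m n x : (m < n)%N -> x \in F m -> x \in acc n.
  elim: n => // n IH; rewrite ltnS leq_eqVlt => /predU1P[->|mn] xF /=.
    by rewrite mem_cat xF.
  by rewrite mem_cat IH ?orbT.
have Fdisj m n x : x \in F m -> x \in F n -> m = n.
  have lem k l : (k < l)%N -> x \in F k -> x \in F l -> False.
    move=> kl xk /(BP (l, acc l)).1[_] /negP; apply; exact: accF kl xk.
  move=> xm xn; have [mn|nm|//] := ltngtP m n.
  - by have := lem _ _ mn xm xn.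
  - by have := lem _ _ nm xn xm.
(* Each [F n] avoids all earlier ones, collected in [acc n]; hence one bounded function carries
   every bad pattern. *)
pose f x : C := if pselect (exists n, x \in F n) is left ex
  then chi R (th (projT1 (cid ex)) x) else 1.
have fE n x : x \in F n -> f x = chi R (th n x).
  move=> xn; rewrite /f; case: pselect => [ex|]; last by case; exists n.
  by case: cid => m xm /=; rewrite (Fdisj _ _ _ xm xn).
have [g gB gf] : exists2 g : G -> C, fourier_stieltjes g & forall t, T t -> g t = f t.
  apply: Tint; exists 1; split; first by rewrite real1.
  move=> M M1 t _; apply: le_trans (ltW M1).
  rewrite modcE /f; case: pselect => [ex|_]; first by rewrite modc_chi.
  by rewrite modc1.
have [K gK] := (fsballP g).1 gB.
have := fsball_unif gK d0; rewrite -[prop_near1 _ _]/(nbhs 0 _) DN => -[r /= r0 hr].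
pose n := maxn (Num.bound K) (Num.bound r^-1).
have gn : level n g.
  split.
    have K0 := fsball_ge0 gK; apply: fsball_le gK.
    apply: le_trans (ltW (archi_boundP K0)) _.
    by rewrite ler_nat leq_maxl.
  move=> v x Vv; apply: hr; apply: lt_le_trans Vv _ => /=.
  have r0' : 0 <= r^-1 by rewrite invr_ge0 ltW.
  rewrite -[leRHS]invrK lef_pV2 ?posrE ?invr_gt0 //.
  apply: le_trans (ltW (archi_boundP r0')) _.
  by rewrite ler_nat leqW // leq_maxr.
apply: ((BP (n, acc n)).2 g gn) => x xF.
by rewrite gf; [exact: (fE n)|exact: (FT n)].
Qed.

End UniformInterpolation.

Section LimitOfSmoothings.
Variables (R : realType) (G : topologicalZmodType).
Local Notation C := (cplx R).
Variables (V : set G) (I : (G -> C) -> C) (k : G -> R).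
Hypothesis hk : haar_kernel V I k.
Variables (J : Type) (F : set_system J) (L : (J -> C) -> C).
Hypotheses (PF : ProperFilter F) (pL : positive_linear (@bounded_fun R J) L).
Hypotheses (L1 : forall a, L (fun=> a) = a).
Hypothesis (Ln : forall f g, (\forall j \near F, f j = g j) -> L f = L g).

(** The four positive definite components are smoothed and passed to the limit separately; each
    limit inherits the bound [K] and the common modulus of continuity. *)
Lemma fsball_limit (K : R) (h : J -> G -> C) : (forall j, fsball K (h j)) ->
  fsball K (fun x => L (fun j => smooth I k (h j) x)).
Proof.
move=> /choice[phi hphi]; have sB := @solid_bounded R.
have [j0 _] := filter_ex (@filterT _ F _).
have K0 : 0 <= K.
  case: (hphi j0) => _ pd pK _; have /ge0cP[_] := pd0_ge0 (pd 0).
  by move/le_trans; apply.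
have pb j l x : modc (phi j l x) <= K.
  by case: (hphi j) => _ pd pK _; exact: le_trans (pd_bound x (pd l)) (pK l).
have bphi j l : bounded_fun (phi j l) by exists K.
have sb j l x : modc (smooth I k (phi j l) x) <= K.
  rewrite -[X in modc X]subr0; apply: (smooth_near hk) => // y z _ _.
  by rewrite subr0.
have bs l x : bounded_fun (fun j => smooth I k (phi j l) x) by exists K.
exists (fun l x => L (fun j => smooth I k (phi j l) x)); split.
- move=> l; apply: continuous_unif => e e0.
  apply: filterS (smooth_equicontinuous hk K0 e0) => v hv x.
  rewrite -(plB (sB J) pL) // -[X in modc X]subr0.
  apply: (mean_le _ pL L1 Ln); last exact: ltW.
  by apply: filterE => j; rewrite subr0; apply: hv.
- move=> l n x c.
  pose g (i i' : 'I_n) j : C := c i * (c i')^* * smooth I k (phi j l) (x i - x i').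
  have bg i i' : bounded_fun (g i i') by exact: (solidZ (sB J)).
  have -> : \sum_(i < n) \sum_(i' < n) c i * (c i')^* *
      L (fun j => smooth I k (phi j l) (x i - x i')) =
      L (fun j => \sum_(i < n) \sum_(i' < n) g i i' j).
    rewrite (pl_sum (sB J) pL); last by move=> i; exact: (solid_sum (sB J)).
    apply: eq_bigr => i _; rewrite (pl_sum (sB J) pL) //.
    by apply: eq_bigr => i' _; rewrite (plZ pL).
  apply: (plge0 pL).
    by apply: (solid_sum (sB J)) => i; exact: (solid_sum (sB J)).
  move=> j; case: (hphi j) => pc pd _ _.
  exact: (smooth_pd hk (pc l) (pd l)).
- move=> l; apply: le_trans (ler_norm _) _; apply: le_trans (Re_le_modc _) _.
  rewrite -[X in modc X]subr0; apply: (mean_le _ pL L1 Ln) => //.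
  by apply: filterE => j; rewrite subr0; apply: sb.
move=> x; rewrite -(eq_bigr _ (fun l _ => plZ pL (chi R l) (bs l x))).
rewrite -(pl_sum (sB J) pL); last by move=> l; exact: (solidZ (sB J)).
congr L; apply/funext => j; rewrite -(smooth_sum hk) //.
by congr (smooth I k _ x); apply/funext => y; case: (hphi j) => _ _ _ ->.
Qed.

End LimitOfSmoothings.

(** * Clamping in the uniform closure *)

Section Clamp.
Variables (R : realType) (G : topologicalZmodType).
Local Notation C := (cplx R).

(** The polynomial iteration for the square root from the Stone-Weierstrass theorem; applied to
    squares it yields absolute values. *)
Fixpoint sqrt_iter (s : R) (n : nat) : R :=
  if n is m.+1 then sqrt_iter s m + 2^-1 * (s - sqrt_iter s m ^+ 2) else 0.

(** The error is multiplied by 1 - (t + p) / 2 at each step. The third bound is the invariant from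
    which the uniform rate 2 / n follows, also near t = 0. *)
Lemma sqrt_iterP (t : R) n : 0 <= t <= 1 ->
  [/\ 0 <= sqrt_iter (t ^+ 2) n, sqrt_iter (t ^+ 2) n <= t
    & (t - sqrt_iter (t ^+ 2) n) * (2 + n%:R * t) <= 2 * t].
Proof.
move=> /andP[t0 t1]; elim: n => [|n [p0 pt pn]] /=.
  by split=> //; rewrite mul0r addr0 subr0 mulrC.
move: p0 pt pn; set p := sqrt_iter _ n => p0 pt pn.
have E : t - (p + 2^-1 * (t ^+ 2 - p ^+ 2)) = (t - p) * (1 - (t + p) / 2) by field.
have n0 : 0 <= n%:R :> R by [].
split.
- by have : 0 <= 2^-1 * (t ^+ 2 - p ^+ 2) by [rewrite mulr_ge0 //; nra]; lra.
- by rewrite -subr_ge0 E mulr_ge0 //; lra.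
rewrite E -[n.+1%:R]natr1; move: pn n0; move: (n%:R : R) => N pn N0.
have h1 : (t - p) * (1 - (t + p) / 2) <= (t - p) * (1 - t / 2).
  by apply: ler_wpM2l; lra.
have h2 : (1 - t / 2) * (2 + (N + 1) * t) <= 2 + N * t by nra.
apply: (@le_trans _ _ ((t - p) * (1 - t / 2) * (2 + (N + 1) * t))).
  by apply: ler_wpM2r => //; nra.
rewrite -mulrA; apply: le_trans pn; apply: ler_wpM2l => //; lra.
Qed.

Lemma sqrt_iter_cvg (t : R) n : 0 <= t <= 1 -> `|t - sqrt_iter (t ^+ 2) n.+1| <= 2 / n.+1%:R.
Proof.
move=> t01; have [p0 pt pn] := sqrt_iterP n.+1 t01; have /andP[t0 t1] := t01.
rewrite ger0_norm ?subr_ge0 // ler_pdivlMr //.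
move: p0 pt pn; set p := sqrt_iter _ _ => p0 pt pn.
have n0 : 0 < n.+1%:R :> R by [].
move: pn n0; move: (n.+1%:R : R) => N pn N0.
move: t0; rewrite le_eqVlt => /predU1P[t0|t0]; first by nra.
have : (t - p) * (N * t) <= 2 * t by nra.
by rewrite mulrA ler_pM2r.
Qed.

Lemma fsball_real_mul (g h : G -> R) K L : fsball K (rc \o g) -> fsball L (rc \o h) ->
  fsball (4 * (K * L)) (rc \o (fun x => g x * h x)).
Proof.
by move=> gK hL; apply: eq_fsball (fsball_mul gK hL) => x /=; rewrite rcM.
Qed.

Lemma fsball_sqrt_iter (g : G -> R) K n : fsball K (rc \o g) ->
  exists L, fsball L (rc \o (fun x => sqrt_iter (g x) n)).
Proof.
move=> gK; elim: n => [|n [L hL]] /=; first exact: (fsball_cst G (0 : C)).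
have [M hM] := fsball_cscale (rc (- 2^-1)) (fsball_real_mul hL hL).
have h2 : 0 <= 2^-1 :> R by [].
eexists; apply: eq_fsball (fsballD (fsballD hL (fsball_scale h2 gK)) hM) => x /=.
by rewrite -!rcM -!rcD; congr rc; ring.
Qed.

Lemma fsball_abs (g : G -> R) K (e : R) : fsball K (rc \o g) -> 0 < e ->
  exists q : G -> R, (exists L, fsball L (rc \o q)) /\ forall x, `| `|g x| - q x | <= e.
Proof.
move=> gK e0.
pose M := 4 * K + 1.
have K0 := fsball_ge0 gK.
have M0 : 0 < M by rewrite /M; lra.
have gM x : 0 <= `|g x| / M <= 1.
  rewrite divr_ge0 ?(ltW M0) //= ler_pdivrMr // mul1r.
  by have := fsball_bound x gK; rewrite modc_rc /M; lra.
have Mi0 : 0 <= M^-1 ^+ 2 by exact: sqr_ge0.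
have gg : fsball (M^-1 ^+ 2 * (4 * (K * K))) (rc \o (fun x => (`|g x| / M) ^+ 2)).
  apply: eq_fsball (fsball_scale Mi0 (fsball_real_mul gK gK)) => x /=.
  by rewrite -rcM; congr rc; rewrite exprMn real_normK ?num_real // mulrC expr2.
pose n := Num.bound (2 * M / e).
have [L hL] := fsball_sqrt_iter n.+1 gg.
exists (fun x => M * sqrt_iter ((`|g x| / M) ^+ 2) n.+1); split.
  exists (M * L); apply: eq_fsball (fsball_scale (ltW M0) hL) => x /=.
  by rewrite rcM.
move=> x; have {1}-> : `|g x| = M * (`|g x| / M) by rewrite mulrC divfK // gt_eqF.
rewrite -mulrBr normrM gtr0_norm //.
apply: le_trans (ler_wpM2l (ltW M0) (sqrt_iter_cvg n (gM x))) _.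
rewrite mulrA ler_pdivrMr // -ler_pdivrMl // [leLHS]mulrC [M * 2]mulrC.
have M2e : 0 <= 2 * M / e by rewrite divr_ge0 ?mulr_ge0 // ltW.
by apply: le_trans (ltW (archi_boundP M2e)) _; rewrite ler_nat.
Qed.

Lemma eberlein_approx (f : G -> C) :
  (forall e : R, 0 < e -> exists2 q, fourier_stieltjes q & forall x, modc (f x - q x) <= e) ->
  eberlein f.
Proof.
move=> h B /= /uniform_nbhs[E [entE EB]].
move: entE; rewrite -entourage_ballE => -[e /= e0 Ee].
have [er0 eE] : 0 < complex.Re e /\ e = rc (complex.Re e).
  have eE := ge0_rc (ltW e0); split=> //.
  by move: e0; rewrite eE /= ltcR.
have [q qB fq] := h (complex.Re e / 2) (divr_gt0 er0 (ltr0n _ 2)).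
exists q; split=> //; apply: EB => y _; apply: Ee.
rewrite /= /ball /= modcE eE ltcR; apply: le_lt_trans (fq y) _; lra.
Qed.

Lemma eberlein_clamp (g : G -> R) K : fsball K (rc \o g) ->
  exists h : G -> C, [/\ eberlein h, forall x, 2^-1 <= g x -> h x = 1
    & forall x, g x <= 4^-1 -> h x = 0].
Proof.
(* [H] is [u] clamped to [0, 1]; u >= 1 means g >= 1/2, and u <= 0 means g <= 1/4. *)
move=> gK; pose u x := 4 * g x - 1.
pose H x := (`|u x| - `|u x - 1| + 1) / 2.
exists (rc \o H); split; last 2 first.
- move=> x gx; rewrite /= /H !ger0_norm /u; [|lra..].
  by rewrite (_ : _ / 2 = 1) //; field.
- move=> x gx; rewrite /= /H !ler0_norm /u; [|lra..].
  by rewrite (_ : _ / 2 = 0) //; field.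
have four : 0 <= 4 :> R by [].
have ushift (a : R) : exists L, fsball L (rc \o (fun x => 4 * g x + a)).
  have [M hM] := fsball_cst G (rc a).
  eexists; apply: eq_fsball (fsballD (fsball_scale four gK) hM) => x /=.
  by rewrite [RHS]rcD rcM.
apply: eberlein_approx => e e0.
have [L1 h1] := ushift (- 1); have [L2 h2] := ushift (- 2).
have [q1 [[M1 q1M] hq1]] := fsball_abs h1 e0.
have [q2 [[M2 q2M] hq2]] := fsball_abs h2 e0.
exists (rc \o (fun x => (q1 x - q2 x + 1) / 2)).
  apply/fsballP.
  have [M3 q3M] := fsball_cst G (1 : C).
  have [M4 q4M] := fsball_cscale (- 1) q2M.
  have [M5 q5M] := fsball_cscale (rc 2^-1) (fsballD (fsballD q1M q4M) q3M).
  exists M5; apply: eq_fsball q5M => x /=.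
  by rewrite mulN1r -rc1 -rcN -!rcD -rcM mulrC.
move=> x; rewrite /= -rcB modc_rc /H /u.
have := hq1 x; have := hq2 x.
rewrite (_ : 4 * g x + - 2 = 4 * g x - 1 - 1); last by ring.
rewrite !ler_norml => /andP[a1 a2] /andP[a3 a4]; apply/andP; split; lra.
Qed.

End Clamp.

(** * Approximability *)

Section Main.
Variables (R : realType) (G : topologicalZmodType).
Local Notation C := (cplx R).

Lemma finite_drury (F0 : seq G) (T V W : set G) (m : nat) (w : G -> C) (be d : R) :
  (forall (F : seq G) (th : G -> 'Z_4), (forall x, x \in F -> T x /\ x \notin F0) ->
    exists phi : G -> C, [/\ fsball m%:R phi,
      forall x, x \in F -> phi x = chi R (th x)
      & forall v x, V v -> modc (phi (x + v) - phi x) <= d]) ->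
  positive_definite w -> continuous w -> w 0 = 1 -> (forall x, modc (w x) <= 1) ->
  (forall x, w x != 0 -> W x) -> 0 < be < 1 -> 0 <= d ->
  exists K : R, forall F : seq G, (forall x, x \in F -> T x /\ x \notin F0) ->
    exists h : G -> C, [/\ fsball K h,
      forall x v, x \in F -> V v -> modc (h (x + v) - w v) <= 2 * d + d ^+ 2
      & forall x, (forall y, y \in F -> ~ W (x - y)) ->
        modc (h x) <= be * (4 * m%:R) ^+ 2].
Proof.
move=> unif wpd wc w0 w1 wW /andP[be0 be1] d0.
pose al := Num.sqrt (1 - be ^+ 2).
have b2 : be ^+ 2 < 1 by rewrite expr_lt1 // ltW.
have al0 : 0 < al by rewrite sqrtr_gt0 subr_gt0.
have albe : al ^+ 2 + be ^+ 2 = 1 by rewrite sqr_sqrtr ?subrK // subr_ge0 ltW.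
have al1 : al <= 1 by nra.
exists (16 * m%:R ^+ 2 / (al * be)) => F' F'T.
(* Without repetitions each point has one index, so any [t] is a pattern on the points. *)
have [F [uF F'E]] : exists F, uniq F /\ F =i F'.
  by exists (undup F'); split; [exact: undup_uniq|exact: mem_undup].
have FT x : x \in F -> T x /\ x \notin F0 by rewrite F'E; exact: F'T.
pose e (j : 'I_(size F)) := nth 0 F j.
pose pat (t : {ffun 'I_(size F) -> 'Z_4}) (x : G) : 'Z_4 :=
  if insub (index x F) is Some j then t j else 0.
have pate t j : pat t (e j) = t j.
  by rewrite /pat /e index_uniq // insubT //= => jF; congr (t _); apply: val_inj.
have /choice[phi hphi] : forall t, exists phi : G -> C, [/\ fsball m%:R phi,
      forall x, x \in F -> phi x = chi R (pat t x)
      & forall v x, V v -> modc (phi (x + v) - phi x) <= d].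
  by move=> t; exact: unif.
have phiK t : fsball m%:R (phi t) by case: (hphi t).
have ab0 : 0 < al * be by rewrite mulr_gt0.
exists (drury e w al be phi); split.
- exact: (fsball_drury e wpd wc w0 albe phiK ab0).
- move=> x v; rewrite -F'E => xF Vv.
  have xlt : (index x F < size F)%N by rewrite index_mem.
  have -> : x = e (Ordinal xlt) by rewrite /e /= nth_index.
  apply: (drury_near (ltW al0) (ltW be0) albe ab0 w1 d0) => t.
  case: (hphi t) => _ h1 h2; rewrite -(pate t) -h1; first exact: h2.
  by rewrite /e mem_nth.
move=> x xW; apply: le_trans (drury_far (W := W) (ltW al0) (ltW be0) albe phiK ab0 w1 wW _) _.
  by move=> j; apply: xW; rewrite -F'E /e mem_nth.
by apply: ler_wpM2r; [exact: sqr_ge0|rewrite ger_pMl].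
Qed.

(** [A] contains the support of w; on [B] both w is close to 1 and the interpolating functions vary
    little; smoothing displaces points by P - P, which the two inclusions absorb. [T1] comes after
    all these choices. *)
Lemma cofinite_approximation (F0 : seq G) (T V2 V1 A B P : set G) (m : nat)
    (w : G -> C) (I : (G -> C) -> C) (k : G -> R) (d be : R) :
  (forall (F : seq G) (th : G -> 'Z_4), (forall x, x \in F -> T x /\ x \notin F0) ->
    exists phi : G -> C, [/\ fsball m%:R phi,
      forall x, x \in F -> phi x = chi R (th x)
      & forall v x, B v -> modc (phi (x + v) - phi x) <= d]) ->
  positive_definite w -> continuous w -> w 0 = 1 -> (forall x, modc (w x) <= 1) ->
  (forall x, w x != 0 -> A x) -> (forall x, B x -> modc (w x - 1) <= d) ->
  0 < be < 1 -> 0 <= d -> haar_kernel P I k ->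
  (forall x y z, A x -> P y -> P z -> V2 (x + (y - z))) ->
  (forall v y z, V1 v -> P y -> P z -> B (v + (z - y))) ->
  forall T1 : set G, T1 `<=` T -> exists (K : R) (h : G -> C), [/\ fsball K h,
    forall x v, T1 x -> x \notin F0 -> V1 v -> modc (h (v + x) - 1) <= 3 * d + d ^+ 2
    & forall x, (forall y, T1 y -> ~ V2 (x - y)) -> modc (h x) <= be * (4 * m%:R) ^+ 2].
Proof.
move=> unif wpd wc w0 w1 wA wB be01 d0 hk AV2 V1B T1 T1T.
have [K hK] := finite_drury unif wpd wc w0 w1 wA be01 d0.
have be0 : 0 <= be by case/andP: be01 => /ltW.
pose good (F : seq G) := [seq x <- F | `[< T1 x >] && (x \notin F0)].
have goodP F x : x \in good F -> [/\ T1 x, T x & x \notin F0].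
  by rewrite mem_filter => /andP[/andP[/asboolP T1x xF0] _]; split=> //; exact: T1T.
have /choice[h hP] : forall F : seq G, exists h : G -> C, [/\ fsball K h,
      forall x v, x \in good F -> B v -> modc (h (x + v) - w v) <= 2 * d + d ^+ 2
      & forall x, (forall y, y \in good F -> ~ A (x - y)) ->
        modc (h x) <= be * (4 * m%:R) ^+ 2].
  by move=> F; apply: hK => x /goodP[_].
have [L [pL L1 Ln]] := @ultra_mean R _ _ (fin_filter_proper G).
have hKF F : fsball K (h F) by case: (hP F).
have bh F : bounded_fun (h F) by exists (4 * K) => x; exact: fsball_bound.
exists K, (fun x => L (fun F => smooth I k (h F) x)); split.
- exact: (fsball_limit hk _ pL L1 Ln).
- move=> x v T1x xF0 V1v.
  have e0 : 0 <= 3 * d + d ^+ 2 by rewrite addr_ge0 ?sqr_ge0 ?mulr_ge0.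
  apply: (mean_le _ pL L1 Ln) => //.
  apply: filterS (fin_filter_mem x) => F xF.
  have xg : x \in good F by rewrite mem_filter xF xF0 !andbT; exact/asboolP.
  case: (hP F) => _ h1 _; apply: (smooth_near hk) => // y z Py Pz.
  have Bv := V1B _ _ _ V1v Py Pz.
  have -> : v + x - y + z = x + (v + (z - y)) by rewrite [v + x]addrC -!addrA [- y + z]addrC.
  (* Passing from w to 1 costs one more d, whence 3 d instead of 2 d. *)
  have -> : h F (x + (v + (z - y))) - 1 =
    h F (x + (v + (z - y))) - w (v + (z - y)) + (w (v + (z - y)) - 1).
    by rewrite [RHS]addrA subrK.
  apply: le_trans (modcD _ _) _; have := h1 _ _ xg Bv; have := wB _ Bv; lra.
move=> x xV2; rewrite -[X in modc X]subr0.
have e0 : 0 <= be * (4 * m%:R) ^+ 2 by rewrite mulr_ge0 ?sqr_ge0.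
apply: (mean_le _ pL L1 Ln) => //; apply: filterE => F.
apply: (smooth_near hk) => // y z Py Pz; rewrite subr0.
case: (hP F) => _ _; apply => t /goodP[T1t _ _] At; apply: (xV2 t T1t).
have <- : x - y + z - t + (y - z) = x - t; last exact: AV2.
by rewrite -[x - y + z]addrA [- y + z]addrC -[z - y]opprB [x - _ - t]addrAC subrK.
Qed.

(** Polarisation: 2 w(x) + i^k w(x - t) + i^(-k) w(x + t) is positive definite for each k, and
    averaging it against i^(-k) isolates w(x - t). *)
Lemma fsball_translate (w : G -> C) (t : G) : continuous w -> positive_definite w ->
  exists K, fsball K (fun x => w (x - t)).
Proof.
move=> wc wpd.
pose y (a : bool) := if a then t else 0.
pose c k (a : bool) : C := if a then chi R k else 1.
pose psi k x := \sum_a \sum_b c k a * (c k b)^* * w (x - y a + y b).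
have psiE k x : psi k x = 2 * w x + chi R k * w (x - t) + chi R (- k) * w (x + t).
  have h1 : chi R k * chi R (- k) = 1 by rewrite -chiD subrr chi0.
  by rewrite /psi !big_bool /= subrK !subr0 !addr0 conjC1 -chiN h1; ring.
have psic k : continuous (psi k).
  have wt s : continuous (fun x => w (x + s)).
    move=> x; have -> : (fun x => w (x + s)) = w \o (fun x => x - (- s)).
      by apply/funext => z; rewrite /= opprK.
    by apply: continuous_comp; [exact: cvg_subr|exact: wc].
  rewrite (_ : psi k = fun x => 2 * w x + chi R k * w (x - t) + chi R (- k) * w (x + t)).
    move=> x; apply: cvgD; last exact: (continuous_scale (wt t)).
    apply: cvgD; first exact: (continuous_scale wc).
    exact: (continuous_scale (wt (- t))).
  by apply/funext => x.
have psipd k : positive_definite (psi k) by exact: pd_conv.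
have q0 : 0 <= 4^-1 :> R by rewrite invr_ge0.
have h k := fsball_chi (- k) (fsball_scale q0 (fsball_pd (psic k) (psipd k))).
eexists; apply: eq_fsball (fsball_sum h) => x.
transitivity (\sum_(k : 'Z_4) rc 4^-1 * (chi R (k * -1) * (2 * w x) + w (x - t)
    + chi R (k * (-1 - 1)) * w (x + t))).
  apply: eq_bigr => k _; rewrite psiE [k * (-1 - 1)]mulrDr mulrN1 chiD.
  have := chiD R (- k) k; rewrite addNr chi0 => h1.
  transitivity (rc 4^-1 * (chi R (- k) * (2 * w x) + (chi R (- k) * chi R k) * w (x - t)
    + chi R (- k) * chi R (- k) * w (x + t))); first by ring.
  by rewrite -h1 mul1r.
rewrite -mulr_sumr !big_split /= -!mulr_suml !sum_chi /= !mul0r add0r addr0.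
rewrite sumr_const card_ord -[w _ *+ _]mulr_natl mulrA.
by rewrite rcV rc_nat mulVf ?mul1r ?pnatr_eq0.
Qed.

End Main.

Theorem proposition3p7 (R : realType) (G : topologicalZmodType)
    (Gmetrizable : metrizable R G)
    (Glc : locally_compact [set: G])
    (T : set G) :
  interpolation_set (@fourier_stieltjes R G) T ->
  approximable_interpolation_set (@eberlein R G) T.
Proof.
move=> Tint; split.
  by move=> f bf; have [g gB gf] := Tint f bf; exists g => //; exact: subset_closure.
(* Then 3 d + d^2 < 1/5, so near T1 \ F0 one gets |h|^2 > 1/2; near F0 the bound 1 - d > 1/2 is
   used. *)
move=> U U0; pose d : R := 1 / 16.
have d0 : 0 < d by rewrite /d; lra.
have [m [F0 [V [V0 unif]]]] := uniform_interpolation Gmetrizable Tint d0.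
pose V2 : set G := interior U.
have V20 : nbhs 0 V2 by exact: nbhs_interior.
have [A A0 AV2] := nbhs0_split V20; have Az := nbhs_singleton A0.
have [Vw Vw0 VwA] := nbhs0_split A0.
have [Iw [kw hw]] := haar_kernel_exists Gmetrizable Glc Vw0.
pose w := autocorr Iw kw.
have wpd : positive_definite w := autocorr_pd hw.
have wc : continuous w := autocorr_continuous hw.
have w0 : w 0 = 1 := autocorr0 hw.
have w1 x : modc (w x) <= 1 by have := pd_bound x wpd; rewrite w0.
have wge0 x : 0 <= complex.Re (w x) by have /ge0cP[] := autocorr_ge0 hw x.
have wA x : w x != 0 -> A x.
  move=> /(autocorr_supp hw)[y Vy Vyx]; have [_] := VwA _ _ Vyx Vy.
  by rewrite addrC addKr.
pose B := V `&` [set x | modc (w x - 1) <= d].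
have B0 : nbhs 0 B.
  apply: filterI => //; have /continuous_modcP/(_ 0 d d0) := wc.
  by apply: filterS => x; rewrite w0 modcB.
have [B1 B10 B1B] := nbhs0_split B0; have B1z := nbhs_singleton B10.
have AB0 : nbhs 0 (A `&` B1) by exact: filterI.
(* The second kernel is chosen after w and [B]: P - P has to fit into [A] for the far estimate and
   into [B1] for the near one. *)
have [P P0 PAB] := nbhs0_split AB0.
pose V1 : set G := interior (A `&` B1).
have V1AB x : V1 x -> A x /\ B1 x by move=> /interior_subset.
have [I [k hk]] := haar_kernel_exists Gmetrizable Glc P0.
(* This gives |h| <= be * c <= 1/4 far from T1, hence |h|^2 <= 1/16, below the clamping threshold
   1/4; the + 2 ensures be < 1. *)
pose c : R := (4 * m%:R) ^+ 2; pose be := (4 * c + 2)^-1.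
have c0 : 0 <= c := sqr_ge0 _.
have c2 : 0 < 4 * c + 2 by lra.
have be01 : 0 < be < 1 by rewrite /be invr_gt0 c2 invf_lt1 //; lra.
have bec : be * c <= 4^-1 by rewrite /be ler_pdivrMl //; lra.
have unifB (F : seq G) (th : G -> 'Z_4) : (forall x, x \in F -> T x /\ x \notin F0) ->
    exists phi : G -> cplx R, [/\ fsball m%:R phi,
      forall x, x \in F -> phi x = chi R (th x)
      & forall v x, B v -> modc (phi (x + v) - phi x) <= d].
  move=> /(unif F th)[phi [p1 p2 p3]]; exists phi; split=> // v x [Vv _].
  exact: p3.
have approx := cofinite_approximation unifB wpd wc w0 w1 wA _ be01 (ltW d0) hk.
exists V1, V2; split.
- by split; [exact: open_interior|exact: AB0].
- by split; [exact: open_interior|exact: U0].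
(* A point x of the closure is y - (y - x) with both y and y - x in [A], and A - A lies in [V2]. *)
- move=> x /(_ [set y | A (y - x)] (nbhs0_shift x A0))[y [/V1AB[Ay _] /= Ayx]].
  by have [_] := AV2 _ _ Ay Ayx; rewrite opprB addrC subrK.
- exact: interior_subset.
move=> T1 T1T.
have [|x y z Ax Py Pz|v y z /V1AB[_ Bv] Py Pz|//|K [h [hK hnear hfar]]] := approx V2 V1 _ _ _ T1.
- by move=> x [_].
- by have [_ [Ayz _]] := PAB _ _ Py Pz; case: (AV2 _ _ Ax Ayz).
- by have [_ [_ Bzy]] := PAB _ _ Pz Py; case: (B1B _ _ Bv Bzy).
pose F1 := [seq t <- F0 | `[< T1 t >]].
(* Replacing [h] by [h] times its conjugate stays in B(G) and makes it real and nonnegative, so the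
   humps at the points of F0 in T1 can be added without cancellation before clamping. *)
pose g x := modc (h x) ^+ 2 + \sum_(t <- F1) complex.Re (w (x - t)).
have [L gL] : exists L, fsball L (rc \o g).
  have [L hL] : exists L, fsball L (fun x => \sum_(t <- F1) w (x - t)).
    clear g; elim: F1 => [|t l [L hL]].
      have [L hL] := fsball_cst G (0 : cplx R).
      by exists L; apply: eq_fsball hL => x; rewrite big_nil.
    have [M hM] := fsball_translate t wc wpd.
    by exists (M + L); apply: eq_fsball (fsballD hM hL) => x; rewrite big_cons.
  eexists; apply: eq_fsball (fsballD (fsball_mul hK (fsball_conj hK)) hL) => x /=.
  rewrite mulJ_modc /g rcD rc_sum; congr (_ + _); apply: eq_bigr => t _.
  exact: (ge0_rc (autocorr_ge0 hw _)).
have gsum0 x : 0 <= \sum_(t <- F1) complex.Re (w (x - t)) by exact: sumr_ge0.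
have [H [EH H1 H0]] := eberlein_clamp gL.
exists H; split=> //.
- move=> _ [_ [v V1v [t T1t <-]] <-] /=; apply: H1.
  have [tF0|tF0] := boolP (t \in F0); last first.
    have := hnear t v T1t tF0 V1v.
    have := modcD (h (v + t)) (1 - h (v + t)); rewrite addrC subrK modc1 modcB.
    have := modc_ge0 (h (v + t)); have := gsum0 (v + t); rewrite /g /d; nra.
  have tF1 : t \in F1 by rewrite mem_filter tF0 andbT; exact/asboolP.
  rewrite /g (big_rem t tF1) /= addrK.
  have [_ Bv] := V1AB _ V1v; have [[_ wv] _] := B1B _ _ Bv B1z.
  move: wv; rewrite /= addr0 => /(le_trans (Re_le_modc _)).
  rewrite !ReImE ler_norml /d => /andP[wv _].
  have s0 : 0 <= \sum_(y <- rem t F1) complex.Re (w (v + t - y)) by exact: sumr_ge0.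
  have := sqr_ge0 (modc (h (v + t))); lra.
move=> _ [x /= nx <-] /=; apply: H0.
have xV2 t : T1 t -> ~ V2 (x - t).
  by move=> T1t V2x; apply: nx; exists (x - t) => //; exists t => //; rewrite subrK.
rewrite /g big_seq big1 => [|t]; last first.
  rewrite mem_filter => /andP[/asboolP T1t _].
  have [->//|/wA Axt] := eqVneq (w (x - t)) 0.
  by have [] := AV2 _ _ Axt Az; rewrite addr0 => /(xV2 t T1t).
have := hfar x xV2; rewrite -/c => hx; have := modc_ge0 (h x).
rewrite addr0; nra.
Qed.
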